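(* Let $A$ and $B$ be two unbounded normal operators on a complex Hilbert space $H$ satisfying $AB\subset BA$. If $B$ is invertible, then $BA$ and $\overline{AB}$ are both normal whenever $AB$ is densely defined.
   Context: All operators are linear. ''Unbounded operator'' means a densely defined, not necessarily bounded, linear operator $A$ with domain $D(A)\subset H$. $A\subset B$ means $D(A)\subset D(B)$ and $A$, $B$ coincide on $D(A)$; equality of operators includes equality of domains. The product $BA$ is defined by $(BA)x=B(Ax)$ on $D(BA)=\{x\in D(A): Ax\in D(B)\}$. $\overline{T}$ denotes the closure of a closable operator $T$. An unbounded operator $B$ is invertible if there is an everywhere defined bounded operator $B^{-1}$ on $H$ with $B^{-1}B\subset BB^{-1}=I$. An unbounded operator $N$ is normal if it is closed (and densely defined) and $NN^*=N^*N$. *)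

(* Defs.v *)
From HB Require Import structures.
From mathcomp Require Import all_boot all_order all_algebra.
From mathcomp Require Import complex.
From mathcomp Require Import boolp classical_sets reals topology normedtype.

Set Implicit Arguments.
Unset Strict Implicit.
Unset Printing Implicit Defensive.

Import Order.TTheory GRing.Theory Num.Theory.
Import numFieldNormedType.Exports.

Local Open Scope classical_set_scope.
Local Open Scope ring_scope.

(* Complex numbers are R[i] for an arbitrary R : realType.
   The inner product is linear in its first argument and conjugate-linear in
   its second one, as for MathComp's [{dot _ for _}]. *)
HB.mixin Record CompleteNormedModule_isHilbert (R : realType) (H : Type)
    & CompleteNormedModule R[i] H := {
  inner : {dot H for (@Num.conj R[i])} ;
  inner_norm : forall x : H, inner x x = `|x| ^+ 2
}.

#[short(type="hilbertType")]
HB.structure Definition Hilbert (R : realType) :=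
  {H of CompleteNormedModule_isHilbert R H & CompleteNormedModule R[i] H}.

Section Operators.
Context {R : realType} {H : hilbertType R}.

(* A partial map of H: the values of [fn] outside [dom] are meaningless, and
   every notion below only depends on the values on [dom].  Linearity is the
   separate predicate [linear_op], so that adjoints and closures are defined
   for every partial map. *)
Record operator := Operator { dom : set H ; fn :> H -> H }.

Implicit Types A B S T N : operator.

Definition linear_op A :=
  dom A 0 /\
  forall (a : R[i]) (x y : H), dom A x -> dom A y ->
    dom A (a *: x + y) /\ A (a *: x + y) = a *: A x + A y.

Definition densely_defined A := dense (dom A).

Definition unbounded_op A := linear_op A /\ densely_defined A.

Definition op_sub A B := dom A `<=` dom B /\ forall x, dom A x -> A x = B x.

Definition op_eq A B := dom A = dom B /\ forall x, dom A x -> A x = B x.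

Definition op_id : operator := Operator setT idfun.

Definition op_mul B A : operator :=
  Operator [set x | dom A x /\ dom B (A x)] (fun x => B (A x)).

Definition graph A : set (H * H) := [set p | dom A p.1 /\ p.2 = A p.1].

Definition closed_op A := closed (graph A).

Definition closable A := forall x y z : H,
  closure (graph A) (x, y) -> closure (graph A) (x, z) -> y = z.

(* When A is closable, this is the operator with graph [closure (graph A)]:
   [xget] then picks the unique y with (x, y) in that set. *)
Definition op_closure A : operator :=
  Operator [set x | exists y, closure (graph A) (x, y)]
           (fun x => xget 0 [set y | closure (graph A) (x, y)]).

Definition adjoint_value A (y z : H) :=
  forall x, dom A x -> inner (A x) y = inner x z.

(* When A is densely defined, the z picked by [xget] is the unique one. *)
Definition adjoint A : operator :=
  Operator [set y | exists z, adjoint_value A y z]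
           (fun y => xget 0 [set z | adjoint_value A y z]).

Definition bounded_everywhere S :=
  [/\ linear_op S, dom S = setT &
      exists M : R, forall x : H, `|S x| <= M%:C%C * `|x|].

Definition invertible B := exists S : operator,
  [/\ bounded_everywhere S,
      op_sub (op_mul S B) (op_mul B S) &
      op_eq (op_mul B S) op_id].

Definition normal N :=
  [/\ unbounded_op N, closed_op N &
      op_eq (op_mul N (adjoint N)) (op_mul (adjoint N) N)].

End Operators.

Arguments operator {R} H.

(* Main.v *)
(* Primes denote adjoints and c inclusion.  Put S = B^-1; then AB c BA says S A c A S.

   Fuglede's theorem (S A' c A' S) is proved for an arbitrary bounded S and an
   unbounded normal A.  The spectral subspaces M of (1 + A'A)^-1 away from 0 reduce A
   to bounded operators, and only 0 is orthogonal to all of them.  For x and y in such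
   subspaces, f(t) = <(1 - tA/n)^n x, S (1 + conj(t) A'/n)^n y> is a polynomial in t which
   differs little from <W x, S W y>, W = ((1 - tA/n)(1 + conj(t) A'/n))^n being nearly
   unitary.  For n large, f is thus bounded on |t| = rho independently of rho, and its
   coefficient <x, S A' y> - <A x, S y> of degree 1 vanishes, as in Liouville's theorem.

   Consequently S and S' commute with A and A'.  The space S D(A) = D(AB) is a core
   of N = BA, so that N is the closure of AB, and N' = B' A'.  Likewise S' D(A) is a
   core of N', and on it |N S' w| = |B S' A w| = |A w| = |A' w| = |N' S' w|.  Hence
   D(N') c D(N) with equal norms; the situation is symmetric, so N is normal. *)

Require Import Defs.
From mathcomp Require Import all_boot all_order all_algebra.
From mathcomp Require Import complex reals topology normedtype.
From mathcomp Require Import boolp classical_sets lra ring.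
From mathcomp Require Import sequences exp.

Set Implicit Arguments.
Unset Strict Implicit.
Unset Printing Implicit Defensive.

Import Order.TTheory GRing.Theory Num.Theory.
Import numFieldNormedType.Exports.

Local Open Scope classical_set_scope.
Local Open Scope ring_scope.

(** The choice of n must follow that of rho. On |t| = rho, f(t) differs from <W x, S W y> by a
    product of a factor at most (1 + (rho r/n)^2)^n - 1, which is small for large n, and one as
    large as exp(rho r)^2, where r bounds A on the reducing subspaces of x and y. The degree of f
    grows with n, but its coefficient of degree 1 does not depend on n, and a bound on a single
    circle controls it. Polynomials thus replace exponentials of operators and analytic functions.

    The only functional calculus is a square root, used to build |T - eps|; no spectral measure
    appears. Fuglede's theorem is what makes the situation symmetric under taking adjoints of A, B
    and S together, so each statement about BA also serves B' A'. *)

(** * Real-valued modulus of complex numbers *)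

Section ComplexModulus.
Context {R : realType}.
Implicit Types a b : R[i].

(** The norm of [R[i]] has values in [R[i]]; estimates are carried out in [R], where the order is
    total and [lra] applies. *)
Definition cabs a : R := complex.Re `|a|.

Lemma cabsE a : `|a| = (cabs a)%:C%C.
Proof. by rewrite /cabs RRe_real ?normr_real. Qed.

Lemma cabs_ge0 a : 0 <= cabs a.
Proof. by rewrite -lecR -cabsE normr_ge0. Qed.

Lemma cabsM a b : cabs (a * b) = cabs a * cabs b.
Proof. by apply: complexI; rewrite rmorphM -!cabsE normrM. Qed.

Lemma cabsD a b : cabs (a + b) <= cabs a + cabs b.
Proof. by rewrite -lecR rmorphD -!cabsE ler_normD. Qed.

Lemma cabsN a : cabs (- a) = cabs a.
Proof. by rewrite /cabs normrN. Qed.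

Lemma cabs_real (x : R) : cabs x%:C%C = `|x|.
Proof.
by apply: complexI; rewrite -cabsE normc_def /= expr0n /= addr0 sqrtr_sqr.
Qed.

Lemma cabs_nat n : cabs n%:R = n%:R.
Proof. by apply: complexI; rewrite -cabsE rmorph_nat normr_nat. Qed.

Lemma cabs0 : cabs 0 = 0.
Proof. exact: (cabs_nat 0). Qed.

Lemma cabs1 : cabs 1 = 1.
Proof. exact: (cabs_nat 1). Qed.

Lemma cabsJ a : cabs (Num.conj a) = cabs a.
Proof. by rewrite /cabs norm_conjC. Qed.

Lemma cabs_eq0 a : cabs a = 0 -> a = 0.
Proof. by move=> h; apply/eqP; rewrite -normr_eq0 cabsE h. Qed.

Lemma cabsX a n : cabs (a ^+ n) = cabs a ^+ n.
Proof. by elim: n => [|n IH]; rewrite ?expr0 ?cabs1 // !exprS cabsM IH. Qed.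

Lemma cabsV a : cabs a^-1 = (cabs a)^-1.
Proof. by apply: complexI; rewrite -cabsE normfV cabsE fmorphV. Qed.

Lemma ReD a b : complex.Re (a + b) = complex.Re a + complex.Re b.
Proof. by case: a b => [? ?] [? ?]. Qed.

Lemma ReN a : complex.Re (- a) = - complex.Re a.
Proof. by case: a. Qed.

Lemma ReB a b : complex.Re (a - b) = complex.Re a - complex.Re b.
Proof. by rewrite ReD ReN. Qed.

Lemma ReJ a : complex.Re (Num.conj a) = complex.Re a.
Proof. by case: a. Qed.

Lemma ReM_real (x : R) a : complex.Re (x%:C%C * a) = x * complex.Re a.
Proof. by case: a => a b /=; rewrite mul0r subr0. Qed.

Lemma Re_le_cabs a : complex.Re a <= cabs a.
Proof.
rewrite (le_trans (ler_norm _)) // -lecR -cabsE; exact: normc_ge_Re.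
Qed.

Lemma ReM_i a : complex.Re ('i%C * a) = - complex.Im a.
Proof. by rewrite mulrC ReiNIm. Qed.

Lemma conj_realC (x : R) : Num.conj (x%:C%C : R[i]) = x%:C%C.
Proof. exact: conjc_real. Qed.

End ComplexModulus.

(** * Norm, inner product and limits *)

Section InnerProduct.
Context {R : realType} {H : hilbertType R}.
Implicit Types x y z : H.

Lemma inDl x y z : inner (x + y) z = inner x z + inner y z.
Proof. exact: linearDl. Qed.
Lemma inDr x y z : inner x (y + z) = inner x y + inner x z.
Proof. exact: linearDr. Qed.
Lemma inNl x z : inner (- x) z = - inner x z.
Proof. exact: linearNl. Qed.
Lemma inNr x z : inner x (- z) = - inner x z.
Proof. exact: linearNr. Qed.
Lemma inBl x y z : inner (x - y) z = inner x z - inner y z.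
Proof. by rewrite inDl inNl. Qed.
Lemma inBr x y z : inner x (y - z) = inner x y - inner x z.
Proof. by rewrite inDr inNr. Qed.
Lemma in0l z : inner 0 z = 0 :> R[i].
Proof. exact: linear0l. Qed.
Lemma in0r z : inner z 0 = 0 :> R[i].
Proof. exact: linear0r. Qed.
Lemma inZl (a : R[i]) x z : inner (a *: x) z = a * inner x z.
Proof. exact: linearZl_LR. Qed.
Lemma inZr (a : R[i]) x z : inner x (a *: z) = Num.conj a * inner x z.
Proof. exact: linearZr_LR. Qed.
Lemma inC x y : inner x y = Num.conj (inner y x) :> R[i].
Proof. by have := hermC (inner : {dot H for _}) x y; rewrite expr0 mul1r. Qed.

(* The norm and the inner product of H have values in R[i]; [nm] is the norm and
   [rin] the real part of the inner product, both with values in R. *)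
Definition nm x : R := complex.Re `|x|.
Definition rin x y : R := complex.Re (inner x y).

Lemma nmE x : `|x| = (nm x)%:C%C.
Proof. by rewrite /nm RRe_real ?normr_real. Qed.
Lemma nm_ge0 x : 0 <= nm x.
Proof. by rewrite -lecR -nmE normr_ge0. Qed.
Lemma nm0 : nm 0 = 0.
Proof. by rewrite /nm normr0. Qed.
Lemma nm_eq0 x : nm x = 0 -> x = 0.
Proof. by move=> h; apply/eqP; rewrite -normr_eq0 nmE h. Qed.
Lemma nmD x y : nm (x + y) <= nm x + nm y.
Proof. by have := ler_normD x y; rewrite !nmE -rmorphD lecR. Qed.
Lemma nmN x : nm (- x) = nm x.
Proof. by rewrite /nm normrN. Qed.
Lemma nmB x y : nm (x - y) <= nm x + nm y.
Proof. by rewrite -(nmN y) nmD. Qed.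
Lemma nmBC x y : nm (x - y) = nm (y - x).
Proof. by rewrite -nmN opprB. Qed.
Lemma nmZ (a : R[i]) x : nm (a *: x) = cabs a * nm x.
Proof. by apply: complexI; rewrite rmorphM -nmE normrZ nmE [X in X * _](cabsE a). Qed.
Lemma nm_tri y x z : nm (x - z) <= nm (x - y) + nm (y - z).
Proof. by rewrite (le_trans _ (nmD _ _)) // addrA subrK. Qed.

Lemma nm_sqr x : nm x ^+ 2 = rin x x.
Proof. by rewrite /rin inner_norm nmE -rmorphXn. Qed.

Lemma innerxx x : inner x x = (rin x x)%:C%C.
Proof. by rewrite inner_norm nmE -rmorphXn nm_sqr. Qed.

Lemma rin_ge0 x : 0 <= rin x x.
Proof. by rewrite -nm_sqr sqr_ge0. Qed.
Lemma rin_eq0 x : rin x x = 0 -> x = 0.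
Proof. by rewrite -nm_sqr => /eqP; rewrite sqrf_eq0 => /eqP/nm_eq0. Qed.
Lemma rin_le0 x : rin x x <= 0 -> x = 0.
Proof. by move=> h; apply: rin_eq0; apply/eqP; rewrite eq_le h rin_ge0. Qed.
Lemma rinC x y : rin x y = rin y x.
Proof. by rewrite /rin inC ReJ. Qed.
Lemma rinDl x y z : rin (x + y) z = rin x z + rin y z.
Proof. by rewrite /rin inDl ReD. Qed.
Lemma rinDr x y z : rin z (x + y) = rin z x + rin z y.
Proof. by rewrite /rin inDr ReD. Qed.
Lemma rinNl x z : rin (- x) z = - rin x z.
Proof. by rewrite /rin inNl ReN. Qed.
Lemma rinNr x z : rin z (- x) = - rin z x.
Proof. by rewrite /rin inNr ReN. Qed.
Lemma rinZl (a : R) x z : rin (a%:C%C *: x) z = a * rin x z.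
Proof. by rewrite /rin inZl ReM_real. Qed.
Lemma rinZr (a : R) x z : rin z (a%:C%C *: x) = a * rin z x.
Proof. by rewrite rinC rinZl rinC. Qed.
Lemma rin0l z : rin 0 z = 0.
Proof. by rewrite /rin in0l. Qed.

Definition rinE := (rinDl, rinDr, rinNl, rinNr, rinZl, rinZr).

Lemma cauchy_schwarz x y : cabs (inner x y) <= nm x * nm y.
Proof.
have [y0|yN0] := eqVneq (rin y y) 0.
  by rewrite (rin_eq0 y0) in0r cabs0 nm0 mulr0.
(* b x - a y is b times the component of x orthogonal to y, written without division. *)
pose b := (rin y y)%:C%C : R[i]; pose a := inner x y.
have hb : Num.conj b = b by exact: conj_realC.
have h0 : 0 <= inner (b *: x - a *: y) (b *: x - a *: y).
  by rewrite inner_norm exprn_ge0.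
move: h0; rewrite !(inBl, inBr, inZl, inZr) hb innerxx (innerxx y) -/b.
rewrite (inC y x) -/a.
have -> : b * (b * (rin x x)%:C%C - Num.conj a * a)
   - (b * (a * Num.conj a) - a * (Num.conj a * b))
   = b * (b * (rin x x)%:C%C - a * Num.conj a) by ring.
rewrite -normCK cabsE -rmorphXn -rmorphM -rmorphB -rmorphM ler0c.
rewrite pmulr_rge0 ?lt_def ?yN0 ?rin_ge0 //.
rewrite -!nm_sqr subr_ge0 -exprMn => h.
by rewrite mulrC -(ler_pXn2r (n := 2)) ?nnegrE ?mulr_ge0 ?nm_ge0 ?cabs_ge0.
Qed.

Lemma rin_le x y : rin x y <= nm x * nm y.
Proof. exact: le_trans (Re_le_cabs _) (cauchy_schwarz _ _). Qed.

Lemma inner_eq0r x : (forall y, inner x y = 0 :> R[i]) -> x = 0.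
Proof. by move=> h; apply: rin_eq0; rewrite /rin h. Qed.

Lemma nm_sqr_le x y : rin x x <= rin y y -> nm x <= nm y.
Proof. by rewrite -!nm_sqr ler_pXn2r ?nnegrE ?nm_ge0. Qed.

Lemma nm_eq x y : rin x x = rin y y -> nm x = nm y.
Proof. by move=> h; apply/eqP; rewrite eq_le !nm_sqr_le ?h. Qed.

(** Limits are handled as explicit epsilon statements over [R]; [cauchyseq_tends], [closure_adhP]
    and [denseE] translate from the topology of [H]. *)
Definition tends (u : nat -> H) x :=
  forall e : R, 0 < e -> exists N, forall n, (N <= n)%N -> nm (u n - x) < e.

Definition cauchyseq (u : nat -> H) :=
  forall e : R, 0 < e -> exists N, forall n m, (N <= n)%N -> (N <= m)%N ->
    nm (u n - u m) < e.

Lemma cauchyseq_tends u : cauchyseq u -> exists x, tends u x.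
Proof.
move=> cu.
have : cauchy (u n @[n --> \oo]).
  apply/cauchy_exP => e e0.
  have e0' : (0 : R) < complex.Re e.
    by move: e0; rewrite ltcE => /andP[].
  have [N hN] := cu _ e0'.
  exists (u N); exists N => // n /= Nn.
  have eE : e = (complex.Re e)%:C%C by rewrite RRe_real ?gtr0_real.
  rewrite -ball_normE /= eE nmE ltcR; exact: hN.
move=> /cauchy_cvgP/cvg_ex[x /= ux].
exists x => e e0.
have e0' : (0 : R[i]) < e%:C%C by rewrite ltcR.
have /cvgrPdist_lt /(_ _ e0') [N _ hN] := ux; exists N => n Nn.
have := hN n Nn; by rewrite /= nmE ltcR nmBC.
Qed.

Definition adh (G : set (H * H)) (p : H * H) :=
  forall e : R, 0 < e -> exists2 q, G q & nm (p.1 - q.1) < e /\ nm (p.2 - q.2) < e.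

Lemma closure_adhP (G : set (H * H)) p : closure G p <-> adh G p.
Proof.
split=> [cG e e0|aG B].
  have e0' : (0 : R[i]) < e%:C%C by rewrite ltcR.
  have /cG [q [Gq [/= h1 h2]]] : nbhs p (ball p e%:C%C) by exact: nbhsx_ballx.
  exists q => //; move: h1 h2.
  by rewrite -!ball_normE /= !nmE !ltcR.
move=> /nbhs_ballP[e /= e0 pB].
have e0' : (0 : R) < complex.Re e by move: e0; rewrite ltcE => /andP[].
have eE : e = (complex.Re e)%:C%C by rewrite RRe_real ?gtr0_real.
have [q Gq [h1 h2]] := aG _ e0'.
exists q; split=> //; apply: pB; split; rewrite -ball_normE /= eE nmE ltcR //.
Qed.

Lemma closed_adhP (G : set (H * H)) : closed G <-> (forall p, adh G p -> G p).
Proof. by split=> cG p; [move/closure_adhP/cG | move/closure_adhP; apply: cG]. Qed.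

Lemma invS_small (e : R) : 0 < e ->
  exists N, forall n, (N <= n)%N -> n.+1%:R^-1 < e.
Proof.
move=> e0; exists (Num.bound e^-1) => n Nn.
rewrite invf_plt ?posrE ?ltr0n //.
apply: (lt_le_trans (archi_boundP _)); first by rewrite invr_ge0 ltW.
by rewrite ler_nat (leq_trans Nn).
Qed.

Lemma adh_seq (G : set (H * H)) p : adh G p ->
  exists u v : nat -> H, [/\ forall n, G (u n, v n), tends u p.1 & tends v p.2].
Proof.
move=> aG.
have h n : exists q, G q /\ nm (p.1 - q.1) < n.+1%:R^-1 /\ nm (p.2 - q.2) < n.+1%:R^-1.
  have [|q] := aG n.+1%:R^-1; first by rewrite invr_gt0 ltr0n.
  by exists q.
have [f hf] := choice h.
exists (fun n => (f n).1), (fun n => (f n).2); split.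
- by move=> n; rewrite -surjective_pairing; case: (hf n).
- move=> e e0; have [N hN] := invS_small e0; exists N => n /hN h1.
  by rewrite nmBC; apply: lt_trans h1; case: (hf n) => _ [].
- move=> e e0; have [N hN] := invS_small e0; exists N => n /hN h1.
  by rewrite nmBC; apply: lt_trans h1; case: (hf n) => _ [].
Qed.

Lemma seq_adh (G : set (H * H)) (u v : nat -> H) x y :
  (forall n, G (u n, v n)) -> tends u x -> tends v y -> adh G (x, y).
Proof.
move=> Gu ux vy e e0; have [N hN] := ux _ e0; have [M hM] := vy _ e0.
exists (u (maxn N M), v (maxn N M)) => //=.
by rewrite nmBC hN ?leq_maxl // nmBC hM ?leq_maxr.
Qed.

Lemma closed_seq (G : set (H * H)) (u v : nat -> H) x y : closed G ->
  (forall n, G (u n, v n)) -> tends u x -> tends v y -> G (x, y).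
Proof. move=> /closed_adhP cG Gu ux vy; apply: cG; exact: seq_adh Gu ux vy. Qed.

Lemma adh_sub (G : set (H * H)) : G `<=` adh G.
Proof. by move=> p Gp e e0; exists p => //; rewrite !subrr nm0. Qed.

Lemma adh_closed (G : set (H * H)) : closed (adh G).
Proof.
apply/closed_adhP => p ap e e0; have e2 : 0 < e / 2 by rewrite divr_gt0.
have [q aq [q1 q2]] := ap _ e2; have [r Gr [r1 r2]] := aq _ e2.
exists r => //; split.
  by rewrite (le_lt_trans (nm_tri q.1 _ _)) // [e]splitr ltrD.
by rewrite (le_lt_trans (nm_tri q.2 _ _)) // [e]splitr ltrD.
Qed.

Lemma adh_min (G F : set (H * H)) : closed F -> G `<=` F -> adh G `<=` F.
Proof.
move=> /closed_adhP cF GF p ap; apply: cF => e e0.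
by have [q Gq ?] := ap _ e0; exists q => //; exact: GF.
Qed.

Lemma tends_cauchyseq u x : tends u x -> cauchyseq u.
Proof.
move=> ux e e0; have e2 : 0 < e / 2 by rewrite divr_gt0.
have [N hN] := ux _ e2; exists N => n m Nn Nm.
by rewrite (le_lt_trans (nm_tri x _ _)) // [e]splitr (nmBC x) ltrD ?hN.
Qed.

Lemma tends_cst x : tends (fun=> x) x.
Proof. by move=> e e0; exists 0%N => n _; rewrite subrr nm0. Qed.

Lemma tendsD u v x y : tends u x -> tends v y -> tends (fun n => u n + v n) (x + y).
Proof.
move=> ux vy e e0; have e2 : 0 < e / 2 by rewrite divr_gt0.
have [N hN] := ux _ e2; have [M hM] := vy _ e2.
exists (maxn N M) => n; rewrite geq_max => /andP[Nn Mn].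
rewrite opprD addrACA (le_lt_trans (nmD _ _)) // [e]splitr ltrD ?hN ?hM //.
Qed.

Lemma tends_lip (K : R) (f : H -> H) u x : 0 <= K ->
  (forall a b, nm (f a - f b) <= K * nm (a - b)) ->
  tends u x -> tends (fun n => f (u n)) (f x).
Proof.
move=> K0 hf ux e e0; have K1 : 0 < K + 1 by rewrite ltr_wpDl.
have [|N hN] := ux (e / (K + 1)); first by rewrite divr_gt0.
exists N => n /hN; rewrite ltr_pdivlMr // => h.
apply: le_lt_trans h; apply: le_trans (hf _ _) _.
by rewrite mulrC ler_wpM2l ?nm_ge0 // lerDl.
Qed.

Lemma tendsZ (a : R[i]) u x : tends u x -> tends (fun n => a *: u n) (a *: x).
Proof.
apply: (@tends_lip (cabs a)); first exact: cabs_ge0.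
by move=> c d; rewrite -scalerBr nmZ.
Qed.

Lemma tends_unique u x y : tends u x -> tends u y -> x = y.
Proof.
move=> ux uy; apply/eqP; rewrite -subr_eq0; apply/eqP/nm_eq0/eqP.
rewrite eq_le nm_ge0 andbT; apply/ler_addgt0Pr => e e0; rewrite add0r.
have e2 : 0 < e / 2 by rewrite divr_gt0.
have [N hN] := ux _ e2; have [M hM] := uy _ e2.
apply: le_trans (nm_tri (u (maxn N M)) _ _) _.
rewrite [e]splitr lerD // ltW // ?hM ?leq_maxr //.
by rewrite nmBC hN ?leq_maxl.
Qed.

Lemma tends_ext u v x : u =1 v -> tends u x -> tends v x.
Proof. by move=> uv ux e /ux[N hN]; exists N => n /hN; rewrite uv. Qed.

Lemma tends_nm_le u x (K : R) : (forall n, nm (u n) <= K) -> tends u x -> nm x <= K.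
Proof.
move=> uK ux; apply/ler_addgt0Pr => e e0; have [N hN] := ux _ e0.
have := nm_tri (u N) x 0; rewrite !subr0 nmBC => h.
by rewrite (le_trans h) // addrC lerD // ltW // hN.
Qed.

Lemma tends_inner_eq u v x y a b : (forall n, inner (u n) a = inner (v n) b :> R[i]) ->
  tends u x -> tends v y -> inner x a = inner y b :> R[i].
Proof.
move=> uv ux vy; apply/eqP; rewrite -subr_eq0; apply/eqP/cabs_eq0/eqP.
rewrite eq_le cabs_ge0 andbT; apply/ler_addgt0Pr => e e0; rewrite add0r.
pose K := nm a + nm b + 1.
have K0 : 0 < K by rewrite ltr_wpDl // addr_ge0 ?nm_ge0.
have e2 : 0 < e / K by rewrite divr_gt0.
have [N hN] := ux _ e2; have [M hM] := vy _ e2.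
pose n := maxn N M.
have -> : inner x a - inner y b = - inner (u n - x) a + inner (v n - y) b.
  by rewrite !inBl uv; ring.
have h1 := hN n (leq_maxl _ _); have h2 := hM n (leq_maxr _ _).
apply: le_trans (cabsD _ _) _; rewrite cabsN.
apply: (@le_trans _ _ (e / K * (nm a + nm b))).
  rewrite mulrDr; apply: lerD.
    by apply: le_trans (cauchy_schwarz _ _) _; rewrite ler_wpM2r ?nm_ge0 ?ltW.
  by apply: le_trans (cauchy_schwarz _ _) _; rewrite ler_wpM2r ?nm_ge0 ?ltW.
by rewrite -mulrA ler_piMr ?(ltW e0) // mulrC ler_pdivrMr // mul1r lerDl ler01.
Qed.

Lemma cauchyseq_eq (u v : nat -> H) :
  (forall n m, nm (u n - u m) = nm (v n - v m)) -> cauchyseq u -> cauchyseq v.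
Proof. by move=> h cu e /cu[N hN]; exists N => n m ? ?; rewrite -h hN. Qed.

End InnerProduct.

(** * Orthogonal projection in H * H *)

Section Projection.
Context {R : realType} {H : hilbertType R}.
Implicit Types (x y z : H) (D : set H) (G : set (H * H)).

Definition lsubspace D :=
  D 0 /\ forall (a : R[i]) x y, D x -> D y -> D (a *: x + y).

Definition linrel G := G (0, 0) /\
  forall (a : R[i]) p q, G p -> G q -> G (a *: p.1 + q.1, a *: p.2 + q.2).

Lemma subspaceD D x y : lsubspace D -> D x -> D y -> D (x + y).
Proof. by move=> [_ h] Dx Dy; rewrite -[x]scale1r; apply: h. Qed.

Lemma subspaceZ D (a : R[i]) x : lsubspace D -> D x -> D (a *: x).
Proof. by move=> [h0 h] Dx; rewrite -[_ *: _]addr0; apply: h. Qed.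

Lemma subspaceN D x : lsubspace D -> D x -> D (- x).
Proof. by move=> sD Dx; rewrite -scaleN1r; apply: subspaceZ. Qed.

Lemma subspaceB D x y : lsubspace D -> D x -> D y -> D (x - y).
Proof. by move=> sD Dx Dy; apply: subspaceD => //; apply: subspaceN. Qed.

Lemma real_quad_ge0 (B Q : R) : 0 <= Q ->
  (forall t : R, 0 <= 2 * t * B + t ^+ 2 * Q) -> B = 0.
Proof.
(* The minimiser would be - B / Q; the denominator Q + 1 stays positive when Q = 0. *)
move=> Q0 h; have := h (- B / (Q + 1)).
have Q1 : 0 < Q + 1 by lra.
have -> : 2 * (- B / (Q + 1)) * B + (- B / (Q + 1)) ^+ 2 * Q
  = - (B ^+ 2 * (Q + 2)) / (Q + 1) ^+ 2 by field; rewrite gt_eqF.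
rewrite pmulr_lge0 ?invr_gt0 ?exprn_gt0 // oppr_ge0 => h2.
apply/eqP; rewrite -sqrf_eq0 eq_le sqr_ge0 andbT.
by rewrite -(pmulr_lle0 _ (x := Q + 2)) //; lra.
Qed.

Lemma complex_eq0 (c : R[i]) : complex.Re c = 0 -> complex.Re ('i%C * c) = 0 -> c = 0.
Proof. by case: c => a b; rewrite ReM_i /= => -> /eqP; rewrite oppr_eq0 => /eqP ->. Qed.

(** The squared distance [J] to (z, y) is minimised over G, and the first variation vanishes at the
    minimum. The sum of the two inner products plays the role of an inner product on H * H. *)
Lemma closed_projection G z y : closed G -> linrel G ->
  exists2 p, G p & forall q, G q -> inner (p.1 - z) q.1 + inner (p.2 - y) q.2 = 0 :> R[i].
Proof.
move=> cG [G0 Glin].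
pose J (p : H * H) := rin (p.1 - z) (p.1 - z) + rin (p.2 - y) (p.2 - y).
have J0 p : 0 <= J p by rewrite addr_ge0 ?rin_ge0.
pose E := [set J p | p in G].
have hE : has_inf E.
  by split; [exists (J (0, 0)); exists (0, 0) | exists 0 => _ [p _ <-]].
pose m := inf E.
have mJ p : G p -> m <= J p by move=> Gp; apply: ge_inf => //; [case: hE | exists p].
have /choice[p hp] : forall n : nat, exists p, G p /\ J p < m + n.+1%:R^-1.
  move=> n; have [|_ [p Gp <-] h] := @inf_adherent _ E n.+1%:R^-1 _ hE.
    by rewrite invr_gt0 ltr0n.
  by exists p.
have Gp n : G (p n) by case: (hp n).
have Jp n : J (p n) < m + n.+1%:R^-1 by case: (hp n).
(* Parallelogram law, the midpoint of a and b being a competitor in G. It makes a minimising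
   sequence Cauchy. *)
have par a b : G a -> G b ->
   rin (a.1 - b.1) (a.1 - b.1) + rin (a.2 - b.2) (a.2 - b.2) <= 2 * J a + 2 * J b - 4 * m.
  move=> Ga Gb.
  pose h : R[i] := (2^-1 : R)%:C%C.
  have Gz c : G c -> G (h *: c.1, h *: c.2).
    by move=> Gc; have := Glin h c (0, 0) Gc G0; rewrite /= !addr0.
  have := mJ _ (Glin h a _ Ga (Gz b Gb)).
  rewrite /J /h /= !rinE !(rinC z) !(rinC y) (rinC b.1 a.1) (rinC b.2 a.2) !mulrA; lra.
have cau : forall e : R, 0 < e -> exists N, forall n k, (N <= n)%N -> (N <= k)%N ->
    rin ((p n).1 - (p k).1) ((p n).1 - (p k).1) +
    rin ((p n).2 - (p k).2) ((p n).2 - (p k).2) < e ^+ 2.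
  move=> e e0; have [|N hN] := @invS_small R (e ^+ 2 / 4).
    by rewrite divr_gt0 ?exprn_gt0.
  exists N => n k Nn Nk; have := par _ _ (Gp n) (Gp k).
  have := Jp n; have := Jp k; have := hN _ Nn; have := hN _ Nk.
  move: (J (p n)) (J (p k)) n.+1%:R^-1 k.+1%:R^-1 => jn jk an ak; lra.
have cau1 : cauchyseq (fun n => (p n).1).
  move=> e e0; have [N hN] := cau _ e0; exists N => n k Nn Nk.
  rewrite -(ltr_pXn2r (n := 2)) ?nnegrE ?nm_ge0 ?ltW // nm_sqr.
  apply: le_lt_trans (hN n k Nn Nk); rewrite lerDl; exact: rin_ge0.
have cau2 : cauchyseq (fun n => (p n).2).
  move=> e e0; have [N hN] := cau _ e0; exists N => n k Nn Nk.
  rewrite -(ltr_pXn2r (n := 2)) ?nnegrE ?nm_ge0 ?ltW // nm_sqr.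
  apply: le_lt_trans (hN n k Nn Nk); rewrite lerDr; exact: rin_ge0.
have [u pu] := cauchyseq_tends cau1; have [v pv] := cauchyseq_tends cau2.
have Guv : G (u, v).
  apply: closed_seq cG _ pu pv => n; rewrite -surjective_pairing; exact: Gp.
exists (u, v) => //=.
pose B (q : H * H) := rin (u - z) q.1 + rin (v - y) q.2.
have B0 q : G q -> B q = 0.
  move=> Gq; pose Q := rin q.1 q.1 + rin q.2 q.2.
  apply: (@real_quad_ge0 _ Q); first by rewrite addr_ge0 ?rin_ge0.
  move=> t; rewrite -subr_le0 sub0r; apply/ler_addgt0Pr => e e0; rewrite add0r.
  (* Replacing the limit by [p n] costs at most (K - 2) * (e / K) in the inner products, and
     [J (p n)] exceeds m by less than e / K; the total stays below e. *)
  pose K := 2 * `|t| * (nm q.1 + nm q.2) + 2.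
  have K2 : 2 <= K.
    by rewrite lerDr; apply: mulr_ge0; [apply: mulr_ge0 | apply: addr_ge0; exact: nm_ge0].
  have K0 : 0 < K by apply: lt_le_trans K2.
  have d0 : 0 < e / K by rewrite divr_gt0.
  have [N1 h1] := pu _ d0; have [N2 h2] := pv _ d0; have [N3 h3] := invS_small d0.
  pose n := maxn N1 (maxn N2 N3).
  have {h1} h1 : nm ((p n).1 - u) < e / K by apply: h1; rewrite leq_maxl.
  have {h2} h2 : nm ((p n).2 - v) < e / K.
    by apply: h2; rewrite /n maxnCA leq_maxl.
  have {h3} h3 : n.+1%:R^-1 < e / K.
    by apply: h3; rewrite /n maxnA leq_maxr.
  have := mJ _ (Glin t%:C%C q _ Gq (Gp n)).
  have := Jp n.
  have -> : J (t%:C%C *: q.1 + (p n).1, t%:C%C *: q.2 + (p n).2) =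
     J (p n) + 2 * t * (B q + (rin ((p n).1 - u) q.1 + rin ((p n).2 - v) q.2)) + t ^+ 2 * Q.
    rewrite /J /B /Q /= !rinE !(rinC z) !(rinC y) (rinC (p n).1 q.1) (rinC (p n).2 q.2).
    rewrite (rinC u) (rinC v); ring.
  have hb : 2 * t * (rin ((p n).1 - u) q.1 + rin ((p n).2 - v) q.2)
      <= 2 * `|t| * (nm q.1 + nm q.2) * (e / K).
    apply: le_trans (ler_norm _) _; rewrite normrM normrM (ger0_norm (x := 2)) //.
    rewrite -[X in _ <= X]mulrA ler_wpM2l ?mulr_ge0 //.
    apply: le_trans (ler_normD _ _) _; rewrite mulrDl lerD //.
      apply: (@le_trans _ _ (nm ((p n).1 - u) * nm q.1)).
        rewrite ler_norml rin_le andbT -(nmN (_ - _)) lerNl -rinNl; exact: rin_le.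
      by rewrite mulrC ler_wpM2l ?nm_ge0 // ltW.
    apply: (@le_trans _ _ (nm ((p n).2 - v) * nm q.2)).
      rewrite ler_norml rin_le andbT -(nmN (_ - _)) lerNl -rinNl; exact: rin_le.
    by rewrite mulrC ler_wpM2l ?nm_ge0 // ltW.
  have eK : 2 * `|t| * (nm q.1 + nm q.2) * (e / K) = e - 2 * (e / K).
    have -> : 2 * `|t| * (nm q.1 + nm q.2) = K - 2 by rewrite addrK.
    by rewrite mulrBl mulrC mulfVK // gt_eqF.
  move: hb h3 d0; rewrite eK; move: (J (p n)) (e / K) n.+1%:R^-1 (B q) (rin _ _ + rin _ _) => j d a b x.
  lra.
move=> q Gq; apply: complex_eq0; first by rewrite ReD; exact: B0.
(* The direction - i q also belongs to G, which yields the imaginary part. *)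
have := B0 _ (Glin (- 'i%C) q _ Gq G0); rewrite /B /rin /= !addr0 !inZr.
rewrite -ReD => h; rewrite -[RHS]h mulrDr.
suff -> : Num.conj (- 'i%C) = 'i%C :> R[i] by [].
by apply/eqP; rewrite eq_complex /= oppr0 opprK !eqxx.
Qed.

Lemma adh_linrel G : linrel G -> linrel (adh G).
Proof.
move=> [G0 Glin]; split; first exact: adh_sub.
move=> a p q /adh_seq[u [v [Guv up vp]]] /adh_seq[u' [v' [Guv' up' vp']]].
apply: (@seq_adh _ _ _ (fun n => a *: u n + u' n) (fun n => a *: v n + v' n)).
- by move=> n; apply: (Glin a (u n, v n) (u' n, v' n)).
- by apply: tendsD => //; exact: tendsZ.
- by apply: tendsD => //; exact: tendsZ.
Qed.

Lemma denseE D : dense D <->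
  forall x (e : R), 0 < e -> exists2 y, D y & nm (x - y) < e.
Proof.
split=> [dD x e e0|hD O [x Ox]].
  have e0' : (0 : R[i]) < e%:C%C by rewrite ltcR.
  have [||y [xy Dy]] := dD (ball x e%:C%C).
  - by exists x; exact: ballxx.
  - exact: ball_open.
  exists y => //; move: xy; by rewrite -ball_normE /= nmE ltcR.
rewrite openE => /(_ _ Ox) /nbhs_ballP[e /= e0 xO].
have e0' : (0 : R) < complex.Re e by move: e0; rewrite ltcE => /andP[].
have eE : e = (complex.Re e)%:C%C by rewrite RRe_real ?gtr0_real.
have [y Dy xy] := hD x _ e0'; exists y; split=> //; apply: xO.
by rewrite -ball_normE /= eE nmE ltcR.
Qed.

Lemma dense_ortho D x : dense D -> (forall y, D y -> inner x y = 0 :> R[i]) -> x = 0.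
Proof.
move=> /denseE dD xD; apply: nm_eq0; apply/eqP; rewrite eq_le nm_ge0 andbT.
apply/ler_addgt0Pr => e e0; rewrite add0r; have [y Dy xy] := dD x _ e0.
have [->|x0] := eqVneq (nm x) 0; first exact: ltW.
have xp : 0 < nm x by rewrite lt_def x0 nm_ge0.
rewrite -(ler_pM2l xp); apply: le_trans (ler_wpM2l (nm_ge0 x) (ltW xy)).
by rewrite -expr2 nm_sqr; apply: le_trans (rin_le _ _); rewrite /rin inBr (xD y Dy) subr0.
Qed.

Lemma ortho_dense D : lsubspace D ->
  (forall x, (forall y, D y -> inner x y = 0 :> R[i]) -> x = 0) -> dense D.
Proof.
move=> [D0 Dlin] oD; apply/denseE => x e e0.
(* D is placed in H * H as D * 0, so that the projection there serves H itself. *)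
pose G : set (H * H) := [set p | D p.1 /\ p.2 = 0].
have lG : linrel G.
  split; first by split.
  by move=> a p q [Dp p2] [Dq q2]; split; rewrite /= ?p2 ?q2 ?scaler0 ?addr0 //; exact: Dlin.
have [p ap op] := closed_projection x 0 (@adh_closed _ _ G) (adh_linrel lG).
have /eqP : p.1 - x = 0.
  apply: oD => y Dy; have /= := op (y, 0) (@adh_sub _ _ G (y, 0) (conj Dy erefl)).
  by rewrite in0r addr0.
rewrite subr_eq0 => /eqP px; have [q [Dq _] [h _]] := ap _ e0.
by exists q.1 => //; rewrite -px.
Qed.

(** A point of F minus its projection on [adh G] is still in F, and it is orthogonal to G. *)
Lemma adh_core G F : linrel G -> linrel F -> closed F -> G `<=` F ->
  (forall p, F p -> (forall q, G q -> inner p.1 q.1 + inner p.2 q.2 = 0 :> R[i]) ->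
     p.1 = 0 /\ p.2 = 0) ->
  F `<=` adh G.
Proof.
move=> lG lF cF GF oG [x y] Fxy.
have [p ap op] := closed_projection x y (@adh_closed _ _ G) (adh_linrel lG).
have Fp : F p by exact: adh_min cF GF _ ap.
have [||/= h1 h2] := oG (p.1 - x, p.2 - y).
- have := lF.2 (-1) _ _ Fxy Fp; by rewrite /= !scaleN1r addrC [- y + _]addrC.
- by move=> q Gq; apply: op; exact: adh_sub.
move: ap; rewrite [p]surjective_pairing.
by move/eqP: h1; rewrite subr_eq0 => /eqP ->; move/eqP: h2; rewrite subr_eq0 => /eqP ->.
Qed.

Lemma linfunP (f : H -> H) (a : R[i]) x y : linear f -> f (a *: x + y) = a *: f x + f y.
Proof. by move=> ->. Qed.

Lemma linfun0 (f : H -> H) : linear f -> f 0 = 0.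
Proof. by move=> lf; have := linfunP (-1) 0 0 lf; rewrite !scaleN1r !addNr. Qed.

Lemma linfunZ (f : H -> H) (a : R[i]) x : linear f -> f (a *: x) = a *: f x.
Proof. by move=> lf; rewrite -[a *: x]addr0 linfunP // linfun0 // addr0. Qed.

Lemma linfunD (f : H -> H) x y : linear f -> f (x + y) = f x + f y.
Proof. by move=> lf; rewrite -[x]scale1r linfunP // !scale1r. Qed.

Lemma linfunN (f : H -> H) x : linear f -> f (- x) = - f x.
Proof. by move=> lf; rewrite -scaleN1r linfunZ // scaleN1r. Qed.

Lemma linfunB (f : H -> H) x y : linear f -> f (x - y) = f x - f y.
Proof. by move=> lf; rewrite linfunD // linfunN. Qed.

(** Riesz representation of x |-> <S x, y>: the representing vector is a multiple of a vector e
    orthogonal to the kernel, obtained by projecting some x0 outside the kernel. *)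
Lemma riesz_adjoint (S : H -> H) (K : R) : linear S ->
  (forall x, nm (S x) <= K * nm x) ->
  exists S' : H -> H, forall x y, inner (S x) y = inner x (S' y) :> R[i].
Proof.
move=> lS SK.
have Slip a b : nm (S a - S b) <= `|K| * nm (a - b).
  have -> : S a - S b = S (a - b) by rewrite linfunB.
  by apply: le_trans (SK _) _; rewrite ler_wpM2r ?nm_ge0 ?ler_norm.
suff h y : exists z, forall x, inner (S x) y = inner x z :> R[i].
  by have [S' hS'] := choice h; exists S' => x y; exact: hS'.
have [[x0 /eqP f0]|f0] := pselect (exists x, inner (S x) y <> 0 :> R[i]); last first.
  by exists 0 => x; rewrite in0r; apply: contrapT => h; apply: f0; exists x.
pose G : set (H * H) := [set p | inner (S p.1) y = 0 :> R[i] /\ p.2 = 0].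
have S0 : S 0 = 0 by exact: linfun0.
have cG : closed G.
  apply/closed_adhP => p /adh_seq[u [v [Guv up vp]]]; split.
    rewrite -(in0l y); apply: (@tends_inner_eq _ _ (fun n => S (u n)) (fun=> 0)).
    - by move=> n; rewrite in0l; case: (Guv n).
    - exact: tends_lip Slip up.
    - exact: tends_cst.
  apply: tends_unique vp _; apply: tends_ext (@tends_cst _ _ 0) => n.
  by case: (Guv n).
have lG : linrel G.
  split; first by split=> //=; rewrite S0 in0l.
  move=> a p q [p1 p2] [q1 q2]; split; rewrite /= ?p2 ?q2 ?scaler0 ?addr0 //.
  by rewrite linfunP // inDl inZl p1 q1 mulr0 addr0.
have [p [p1 p2] op] := closed_projection x0 0 cG lG.
pose e := p.1 - x0.
have fe : inner (S e) y = - inner (S x0) y :> R[i].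
  by rewrite /e linfunB // inBl p1 sub0r.
have fe0 : inner (S e) y != 0 :> R[i] by rewrite fe oppr_eq0.
have e0 : inner e e != 0 :> R[i].
  apply: contra fe0 => /eqP e0; have -> : e = 0 by apply: rin_eq0; rewrite /rin e0.
  by rewrite S0 in0l.
exists (Num.conj (inner (S e) y / inner e e) *: e) => x.
rewrite inZr conjCK.
(* This combination of e and x lies in the kernel, hence is orthogonal to e. *)
have := op (inner (S x) y *: e + (- inner (S e) y) *: x, 0) _.
rewrite in0r addr0 inDr !inZr => h.
have {h} : inner (inner (S x) y *: e + (- inner (S e) y) *: x) e = 0 :> R[i].
  rewrite inC inDr !inZr h ?rmorph0 //; split=> //=.
  by rewrite linfunP // linfunZ // inDl !inZl; ring.
rewrite inDl !inZl => h.
have -> : inner (S e) y / inner e e * inner x e =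
  (inner (S x) y * inner e e - (inner (S x) y * inner e e - inner (S e) y * inner x e)) / inner e e
  by ring.
by rewrite -mulNr h subr0 mulfK.
Qed.

End Projection.

(** * Adjoints and normal operators *)

Section Adjoints.
Context {R : realType} {H : hilbertType R}.
Implicit Types (A B N : operator H) (x y z u v w : H).

Lemma tends_nm_eq (u v : nat -> H) x y : (forall n, nm (u n) = nm (v n)) ->
  tends u x -> tends v y -> nm x = nm y.
Proof.
have key (a b : nat -> H) s t : (forall n, nm (a n) = nm (b n)) ->
    tends a s -> tends b t -> nm s <= nm t.
  move=> ab as_ bt; apply/ler_addgt0Pr => e e0; have e2 : 0 < e / 2 by rewrite divr_gt0.
  have [N1 h1] := as_ _ e2; have [N2 h2] := bt _ e2; pose n := maxn N1 N2.
  have := h1 n (leq_maxl _ _); have := h2 n (leq_maxr _ _).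
  have := nm_tri (a n) s 0; have := nm_tri t (b n) 0.
  rewrite !subr0 ab (nmBC s); lra.
move=> uv ux vy; apply/eqP; rewrite eq_le (key _ _ _ _ uv ux vy).
by rewrite (key v u y x (fun n => esym (uv n)) vy ux).
Qed.

Section LinearOp.
Variable A : operator H.
Hypothesis lA : linear_op A.

Lemma linop_dom0 : dom A 0. Proof. exact: (proj1 lA). Qed.
Lemma linopP (a : R[i]) x y : dom A x -> dom A y -> A (a *: x + y) = a *: A x + A y.
Proof. by move=> Dx Dy; have [_ /(_ a _ _ Dx Dy)[]] := lA. Qed.
Lemma linop_subspace : lsubspace (dom A).
Proof. by split=> [|a x y Dx Dy]; [exact: linop_dom0 | have [_ /(_ a _ _ Dx Dy)[]] := lA]. Qed.
Lemma linop0 : A 0 = 0.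
Proof.
have := linopP (-1) linop_dom0 linop_dom0.
by rewrite !scaleN1r !addNr.
Qed.
Lemma linopZ (a : R[i]) x : dom A x -> A (a *: x) = a *: A x.
Proof. by move=> Dx; rewrite -[a *: x]addr0 linopP ?linop0 ?addr0 //; exact: linop_dom0. Qed.
Lemma linopD x y : dom A x -> dom A y -> A (x + y) = A x + A y.
Proof. by move=> Dx Dy; rewrite -[x]scale1r linopP // !scale1r. Qed.
Lemma linopN x : dom A x -> A (- x) = - A x.
Proof. by move=> Dx; rewrite -scaleN1r linopZ // scaleN1r. Qed.
Lemma linopB x y : dom A x -> dom A y -> A (x - y) = A x - A y.
Proof. by move=> Dx Dy; rewrite linopD ?linopN //; apply: subspaceN => //; exact: linop_subspace. Qed.

Lemma linop_linrel : linrel (graph A).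
Proof.
split; first by split; [exact: linop_dom0 | rewrite /= linop0].
move=> a p q [Dp p2] [Dq q2]; split=> /=; first by apply: (proj2 linop_subspace).
by rewrite p2 q2 linopP.
Qed.

End LinearOp.

Lemma closedop_seq A (u : nat -> H) x y : closed_op A -> (forall n, dom A (u n)) ->
  tends u x -> tends (fun n => A (u n)) y -> dom A x /\ A x = y.
Proof.
move=> cA Du ux uy; have [|Dx /= ->] := closed_seq cA _ ux uy; last by split.
by move=> n; split=> /=.
Qed.

Lemma adjoint_valueP A y z : densely_defined A ->
  adjoint_value A y z <-> dom (adjoint A) y /\ adjoint A y = z.
Proof.
move=> dA; split=> [yz|[[z' yz'] <-]]; last by have := @xgetI _ 0 [set z | adjoint_value A y z] z' yz'.
split; first by exists z.
rewrite /=; have h := @xgetI _ 0 [set z | adjoint_value A y z] z yz.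
apply/eqP; rewrite -subr_eq0; apply/eqP; apply: (dense_ortho dA) => x Dx.
by rewrite inBl [X in X - _]inC [X in _ - X]inC -yz // -h // subrr.
Qed.

Lemma adjoint_linear A : densely_defined A -> linear_op (adjoint A).
Proof.
move=> dA; split; first by exists 0 => x _; rewrite !in0r.
move=> a x y Dx Dy; have hx := (adjoint_valueP _ _ dA).2 (conj Dx erefl).
have hy := (adjoint_valueP _ _ dA).2 (conj Dy erefl).
by apply/adjoint_valueP => // w Dw; rewrite !inDr !inZr hx // hy.
Qed.

Lemma adjoint_closed A : densely_defined A -> closed_op (adjoint A).
Proof.
move=> dA; apply/closed_adhP => -[x y] /adh_seq[u [v [Guv ux vy]]].
suff /(adjoint_valueP _ _ dA)[Dx e] : adjoint_value A x y by split.
move=> w Dw; rewrite inC [RHS]inC; congr (Num.conj _).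
apply: tends_inner_eq ux vy => n; have [/= Du ->] := Guv n.
by rewrite inC [RHS]inC; congr (Num.conj _); apply: (adjoint_valueP _ _ dA).2.
Qed.

(* Von Neumann: the orthogonal complement of the graph of A in H * H consists of
   the pairs (A' v, - v), A' being the adjoint. *)
Lemma graph_decomposition A x y : linear_op A -> closed_op A ->
  exists2 u, dom A u & adjoint_value A (A u - y) (x - u).
Proof.
move=> lA cA; have [[u v] /= [/= Du ->] op] := closed_projection x y cA (linop_linrel lA).
exists u => // w Dw; have /= := op (w, A w) (conj Dw erefl).
rewrite (inC _ w) (inC _ (A w)) -rmorphD => /eqP; rewrite conjC_eq0.
by rewrite addrC addr_eq0 => /eqP ->; rewrite -inNr opprB.
Qed.

(** The component of (x, y) orthogonal to the graph of A comes from the adjoint, so the hypothesis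
    makes it orthogonal to (x, y), hence to itself. *)
Lemma biadjoint A x y : linear_op A -> closed_op A -> densely_defined A ->
  adjoint_value (adjoint A) x y -> dom A x /\ A x = y.
Proof.
move=> lA cA dA xy; have [u Du uv] := graph_decomposition x y lA cA.
have [Dv ev] := (adjoint_valueP _ _ dA).1 uv.
have h1 := xy _ Dv; rewrite ev in h1.
have h2 := uv u Du.
have h3 : inner (x - u) (x - u) + inner (A u - y) (A u - y) = 0 :> R[i].
  rewrite [in X in X + _]inBr h1 [X in _ - X]inC -h2 -inC -inBr.
  by rewrite -inDr -opprB subrr in0r.
have {}h3 : rin (x - u) (x - u) + rin (A u - y) (A u - y) = 0.
  by have := congr1 (@complex.Re R) h3; rewrite ReD.
have /eqP : x - u = 0 by apply: rin_le0; have := rin_ge0 (A u - y); lra.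
have /eqP : A u - y = 0 by apply: rin_le0; have := rin_ge0 (x - u); lra.
by rewrite !subr_eq0 => /eqP <- /eqP ->.
Qed.

(** If q is orthogonal to the domain of the adjoint, then (0, q) lies in the graph of the biadjoint,
    which is A, and q = A 0. *)
Lemma adjoint_dense A : linear_op A -> closed_op A -> densely_defined A ->
  densely_defined (adjoint A).
Proof.
move=> lA cA dA; apply: ortho_dense; first exact/linop_subspace/adjoint_linear.
move=> q hq; have [|_ <-] := @biadjoint A 0 q lA cA dA; last exact: linop0.
by move=> y Dy; rewrite in0r inC hq // rmorph0.
Qed.

(* A normal operator together with its adjoint, in a form that is symmetric in the
   two: every lemma about A has its counterpart about A' through [np_sym]. *)
Record normal_pair A A' : Prop := NormalPair {
  np_lin : linear_op A;
  np_dense : densely_defined A;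
  np_closed : closed_op A;
  np_lin' : linear_op A';
  np_dense' : densely_defined A';
  np_closed' : closed_op A';
  np_adj : forall y z, adjoint_value A y z -> dom A' y /\ A' y = z;
  np_adj' : forall y z, adjoint_value A' y z -> dom A y /\ A y = z;
  np_inner : forall x y, dom A x -> dom A' y -> inner (A x) y = inner x (A' y) :> R[i];
  np_comm : forall x, dom A x -> dom A' (A x) ->
    [/\ dom A' x, dom A (A' x) & A (A' x) = A' (A x)];
  np_comm' : forall x, dom A' x -> dom A (A' x) ->
    [/\ dom A x, dom A' (A x) & A' (A x) = A (A' x)]
}.

Lemma np_sym A A' : normal_pair A A' -> normal_pair A' A.
Proof.
case=> lA dA cA lA' dA' cA' a a' i c c'; apply: NormalPair => // x y Dx Dy.
by rewrite inC [RHS]inC i.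
Qed.

Lemma normal_np A : normal A -> normal_pair A (adjoint A).
Proof.
case=> -[lA dA] cA [eD eV]; split=> //.
- exact: adjoint_linear.
- exact: adjoint_dense.
- exact: adjoint_closed.
- by move=> y z /adjoint_valueP -/(_ dA).
- by move=> y z; exact: biadjoint.
- by move=> x y Dx Dy; apply: (adjoint_valueP _ _ dA).2.
- move=> x Dx DAx.
  have h : dom (op_mul A (adjoint A)) x by rewrite eD.
  by case: (h) => h1 h2; split=> //; exact: eV.
- move=> x Dx DAx.
  have h : dom (op_mul (adjoint A) A) x by rewrite -eD.
  by case: (h) => h1 h2; split=> //; apply/esym/eV.
Qed.

(** Decompose (x, 0) along the graph of A: the component (u, A u) satisfies A' (A u) = x - u. *)
Lemma resolvent A A' x : normal_pair A A' ->
  exists u, [/\ dom A u, dom A' (A u) & u + A' (A u) = x].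
Proof.
move=> np; have [u Du] := graph_decomposition x 0 (np_lin np) (np_closed np).
rewrite subr0 => /(np_adj np)[DAu e]; exists u; split=> //.
by rewrite e addrC subrK.
Qed.

Lemma np_norm2 A A' x : normal_pair A A' -> dom A x -> dom A' (A x) ->
  nm (A' x) = nm (A x).
Proof.
move=> np Dx DAx; have [Dx' DA'x e] := np_comm np Dx DAx.
apply: nm_eq; rewrite /rin -(np_inner np) // e.
by rewrite inC ReJ -(np_inner np).
Qed.

(* The equality of norms is immediate on the domain of A'A, which is a core of A:
   a vector of the graph orthogonal to that part is orthogonal to the range of
   1 + A'A, which is everything. *)
Lemma np_dom A A' x : normal_pair A A' -> dom A x -> dom A' x /\ nm (A' x) = nm (A x).
Proof.
move=> np Dx.
have lA := np_lin np; have lA' := np_lin' np.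
pose G : set (H * H) := [set p | [/\ dom A p.1, dom A' (A p.1) & p.2 = A p.1]].
have lG : linrel G.
  split; first by rewrite /G /= linop0 //; split=> //; exact: linop_dom0.
  move=> a p q [p1 p2 p3] [q1 q2 q3]; split=> /=; rewrite ?p3 ?q3 ?linopP //.
    exact: (proj2 (linop_subspace lA)).
  exact: (proj2 (linop_subspace lA')).
have core : graph A `<=` adh G.
  apply: adh_core lG (linop_linrel lA) (np_closed np) _ _.
    by move=> p [].
  move=> p [p1 p2] op; suff p0 : p.1 = 0 by rewrite p2 p0 linop0.
  have [v [Dv DAv e]] := resolvent p.1 np.
  have /= := op (v, A v) (And3 Dv DAv erefl).
  by rewrite p2 (np_inner np) // -inDr e => h; apply: rin_eq0; rewrite /rin h.
have [u [v [Guv /= ux vx]]] := adh_seq (core (x, A x) (conj Dx erefl)).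
have Du n : dom A (u n) by case: (Guv n).
have DAu n : dom A' (A (u n)) by case: (Guv n).
have vE n : v n = A (u n) by case: (Guv n).
have Du' n : dom A' (u n) by case: (np_comm np (Du n) (DAu n)).
have [w wx] : exists w, tends (fun n => A' (u n)) w.
  apply/cauchyseq_tends/(cauchyseq_eq _ (tends_cauchyseq vx)) => n m.
  have Dd : dom A (u n - u m) by apply: subspaceB => //; exact: linop_subspace.
  rewrite !vE -!linopB // (np_norm2 np) //.
  by rewrite linopB //; apply: subspaceB => //; exact: linop_subspace.
have [Dx' A'x] := closedop_seq (np_closed' np) Du' ux wx.
split=> //; rewrite A'x; apply: tends_nm_eq wx vx => n.
by rewrite vE (np_norm2 np).
Qed.

Lemma np_nm A A' x : normal_pair A A' -> dom A x -> nm (A' x) = nm (A x).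
Proof. by move=> np Dx; case: (np_dom np Dx). Qed.

Lemma np_domE A A' x : normal_pair A A' -> dom A' x <-> dom A x.
Proof. by move=> np; split; [case/(np_dom (np_sym np)) | case/(np_dom np)]. Qed.

Lemma polarization (D : set H) (f g : H -> H) : lsubspace D ->
  (forall (a : R[i]) x y, D x -> D y -> f (a *: x + y) = a *: f x + f y) ->
  (forall (a : R[i]) x y, D x -> D y -> g (a *: x + y) = a *: g x + g y) ->
  (forall x, D x -> nm (f x) = nm (g x)) ->
  forall x y, D x -> D y -> inner (f x) (f y) = inner (g x) (g y) :> R[i].
Proof.
move=> sD lf lg fg.
have re x y : D x -> D y -> rin (f x) (f y) = rin (g x) (g y).
  move=> Dx Dy; have := fg (1 *: x + y) ((proj2 sD) 1 x y Dx Dy).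
  move/(congr1 (fun r => r ^+ 2)); rewrite !nm_sqr lf // lg // !scale1r !rinE.
  have := congr1 (fun r => r ^+ 2) (fg x Dx); rewrite /= !nm_sqr.
  have := congr1 (fun r => r ^+ 2) (fg y Dy); rewrite /= !nm_sqr.
  rewrite (rinC (f y) (f x)) (rinC (g y) (g x)); lra.
move=> x y Dx Dy; apply/eqP; rewrite -subr_eq0; apply/eqP.
have D0 := proj1 sD.
apply: complex_eq0; first by rewrite ReB; apply/eqP; rewrite subr_eq0; apply/eqP/re.
have f0 : f 0 = 0 by have := lf (-1) 0 0 D0 D0; rewrite !scaleN1r !addNr.
have g0 : g 0 = 0 by have := lg (-1) 0 0 D0 D0; rewrite !scaleN1r !addNr.
have := re ('i%C *: x + 0) y ((proj2 sD) _ x 0 Dx D0) Dy.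
rewrite lf // lg // f0 g0 !addr0 /rin !inZl mulrBr ReB => ->; exact: subrr.
Qed.

(** Polarization gives <N' x, N' y> = <N x, N y>. Read as a functional of y, this exhibits N (N' x)
    as the adjoint's value at N x, and N' (N x) as the value at N' x of the biadjoint, that is of
    N. *)
Lemma normal_of_norms N : linear_op N -> densely_defined N -> closed_op N ->
  (forall x, dom N x <-> dom (adjoint N) x) ->
  (forall x, dom N x -> nm (adjoint N x) = nm (N x)) -> normal N.
Proof.
move=> lN dN cN hD hN; split=> //.
have lN' := adjoint_linear dN.
have pol : forall x y, dom N x -> dom N y ->
    inner (adjoint N x) (adjoint N y) = inner (N x) (N y) :> R[i].
  apply: (polarization (linop_subspace lN)) => // a x y Dx Dy.
    by apply: linopP => //; apply/hD.
  exact: linopP.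
have adjE x y : dom N x -> dom (adjoint N) y -> inner (N x) y = inner x (adjoint N y) :> R[i].
  by move=> Dx Dy; apply: (adjoint_valueP _ _ dN).2.
have fwd x : dom (adjoint N) x -> dom N (adjoint N x) ->
    dom (adjoint N) (N x) /\ adjoint N (N x) = N (adjoint N x).
  move=> Dx DNx; apply/adjoint_valueP => // y Dy.
  have Dy' := (proj1 (hD y)) Dy; have Dx' := (proj2 (hD x)) Dx.
  by rewrite -pol // inC -adjE // -inC.
have bwd x : dom N x -> dom (adjoint N) (N x) -> dom N (adjoint N x).
  move=> Dx DNx; case: (@biadjoint N (adjoint N x) (adjoint N (N x)) lN cN dN) => //.
  move=> y Dy'; have Dy := (proj2 (hD y)) Dy'.
  by rewrite pol // adjE.
split=> /=.
  apply/seteqP; split=> x [] /=.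
    move=> Dx DNx; split; first exact/hD.
    by case: (fwd x Dx DNx).
  move=> Dx DNx; split; first exact/hD.
  exact: bwd.
by move=> x [Dx DNx]; case: (fwd x Dx DNx).
Qed.

End Adjoints.

(** * Bounded reducing subspaces *)

Section OperatorModulus.
Context {R : realType} {H : hilbertType R}.
Implicit Types (A B N : operator H) (x z u v w : H) (f y : H -> H).

Definition commutes A f := forall x, dom A x -> dom A (f x) /\ A (f x) = f (A x).

(** The tails of v are dominated by those of c, which increases because its increments bound norms,
    and therefore converges to its supremum. *)
Lemma increasing_cauchyseq (c : nat -> R) (L : R) (v : nat -> H) :
  (forall n, c n <= L) -> (forall n, nm (v n.+1 - v n) <= c n.+1 - c n) ->
  cauchyseq v.
Proof.
move=> cL vc.
have step n p : nm (v (n + p)%N - v n) <= c (n + p)%N - c n.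
  elim: p => [|p IH]; first by rewrite addn0 !subrr nm0.
  rewrite addnS; apply: le_trans (nm_tri (v (n + p)%N) _ _) _.
  by have := vc (n + p)%N; move: IH; lra.
have cmono n p : c n <= c (n + p)%N.
  by rewrite -subr_ge0; apply: le_trans (step n p); exact: nm_ge0.
pose E := [set c n | n in setT].
have hE : has_sup E.
  by split; [exists (c 0%N); exists 0%N | exists L => _ [n _ <-]].
move=> e e0; have e2 : 0 < e / 2 by rewrite divr_gt0.
have [_ [N _ <-] hN] := sup_adherent e2 hE.
have small n : (N <= n)%N -> nm (v n - v N) < e / 2.
  move=> Nn; rewrite -(subnKC Nn); apply: le_lt_trans (step _ _) _.
  have : c (N + (n - N))%N <= sup E by apply: ub_le_sup; [case: hE | exists (N + (n - N))%N].
  by move: hN; lra.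
exists N => n m Nn Nm; apply: le_lt_trans (nm_tri (v N) _ _) _.
by rewrite [e]splitr ltrD ?small // nmBC small.
Qed.

(** Scalar majorant of [sqrt_iter]: the iteration c |-> (1 + c^2) / 2 started at 0, which stays
    below its fixed point 1. *)
Fixpoint sqrt_bound (n : nat) : R :=
  if n is n'.+1 then (1 + sqrt_bound n' ^+ 2) / 2 else 0.

Lemma sqrt_bound_itv n : 0 <= sqrt_bound n <= 1.
Proof.
elim: n => [|n /andP[h0 h1]] /=; first by rewrite lexx ler01.
have := sqr_ge0 (sqrt_bound n).
have : sqrt_bound n ^+ 2 <= 1 by rewrite exprn_ile1.
by move=> ? ?; apply/andP; split; lra.
Qed.

Lemma sqrt_bound_ge0 n : 0 <= sqrt_bound n.
Proof. by case/andP: (sqrt_bound_itv n). Qed.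

Lemma sqrt_bound_le1 n : sqrt_bound n <= 1.
Proof. by case/andP: (sqrt_bound_itv n). Qed.

Definition half : R[i] := (2^-1 : R)%:C%C.

Lemma cabs_half : cabs half = 2^-1.
Proof. by rewrite cabs_real ger0_norm // invr_ge0. Qed.

Lemma halfD : half + half = 1.
Proof. by apply/eqP; rewrite eq_complex /= addr0 eqxx andbT; apply/eqP; lra. Qed.

Section SquareRoot.
Variable b : H -> H.
Hypothesis lb : linear b.
Hypothesis b1 : forall x, nm (b x) <= nm x.

(* The iterates converge to a solution of q = (b + q^2) / 2, i.e. (1 - q)^2 = 1 - b;
   the increments are dominated by those of the same scalar iteration with b = 1. *)
Fixpoint sqrt_iter n x : H :=
  if n is n'.+1 then half *: (b x + sqrt_iter n' (sqrt_iter n' x)) else 0.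

Lemma sqrt_iter_linear n : linear (sqrt_iter n).
Proof.
elim: n => [|n IH] a x y /=; first by rewrite scaler0 addr0.
rewrite !(linfunP _ _ _ lb) !(linfunP _ _ _ IH) !scalerDr !scalerA.
rewrite ![half * a]mulrC; rewrite addrACA; congr (_ + _).
Qed.

Lemma sqrt_iter_le n x : nm (sqrt_iter n x) <= sqrt_bound n * nm x.
Proof.
elim: n x => [|n IH] x /=; first by rewrite nm0 mul0r.
rewrite nmZ cabs_half mulrC [_ / 2 * _]mulrAC ler_wpM2r ?invr_ge0 //.
apply: le_trans (nmD _ _) _; rewrite mulrDl mul1r lerD // expr2 -mulrA.
by apply: le_trans (IH _) _; rewrite ler_wpM2l ?sqrt_bound_ge0.
Qed.

Lemma sqrt_iter_step n x :
  nm (sqrt_iter n.+1 x - sqrt_iter n x) <= (sqrt_bound n.+1 - sqrt_bound n) * nm x.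
Proof.
elim: n x => [|n IH] x.
  rewrite /= !subr0 expr0n /= !addr0 nmZ cabs_half mulrC mul1r [_^-1 * _]mulrC.
  by rewrite ler_wpM2r // ?invr_ge0.
rewrite [sqrt_iter n.+2 x]/= [sqrt_iter n.+1 x in X in _ - X]/=.
rewrite -scalerBr opprD addrACA subrr add0r nmZ cabs_half.
set s := sqrt_iter n.+1; set t := sqrt_iter n.
have ls : linear s := sqrt_iter_linear n.+1.
(* The splitting s^2 - t^2 = s (s - t) + (s - t) t; the scalar increment is split alike and
   dominates term by term. *)
have -> : s (s x) - t (t x) = s (s x - t x) + (s (t x) - t (t x)).
  by rewrite (linfunB _ _ ls) addrA subrK.
have -> : sqrt_bound n.+2 - sqrt_bound n.+1 =
   2^-1 * (sqrt_bound n.+1 * (sqrt_bound n.+1 - sqrt_bound n)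
     + (sqrt_bound n.+1 - sqrt_bound n) * sqrt_bound n).
  have e2 : sqrt_bound n.+2 = (1 + sqrt_bound n.+1 ^+ 2) / 2 by [].
  have e1 : sqrt_bound n.+1 = (1 + sqrt_bound n ^+ 2) / 2 by [].
  move: (sqrt_bound n.+2) (sqrt_bound n.+1) (sqrt_bound n) e2 e1 => c2 c1 c0; lra.
rewrite -mulrA ler_wpM2l // ?invr_ge0 //.
have d0 : 0 <= sqrt_bound n.+1 - sqrt_bound n.
  have := sqr_ge0 (1 - sqrt_bound n); rewrite /=; lra.
apply: le_trans (nmD _ _) _; rewrite mulrDl lerD //.
  apply: le_trans (sqrt_iter_le _ _) _.
  by rewrite -mulrA ler_wpM2l ?sqrt_bound_ge0.
by apply: le_trans (IH _) _; rewrite -mulrA ler_wpM2l // sqrt_iter_le.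
Qed.

Lemma sqrt_iter_tends : exists q : H -> H, forall x, tends (fun n => sqrt_iter n x) (q x).
Proof.
suff h x : exists z, tends (fun n => sqrt_iter n x) z by have [q hq] := choice h; exists q.
apply: cauchyseq_tends.
apply: (@increasing_cauchyseq (fun n => sqrt_bound n * nm x) (nm x)) => n.
  by rewrite -[leRHS]mul1r ler_wpM2r ?nm_ge0 ?sqrt_bound_le1.
by rewrite -mulrBl sqrt_iter_step.
Qed.

Lemma sqrt_iter_commutes A : linear_op A -> commutes A b ->
  forall n, commutes A (sqrt_iter n).
Proof.
move=> lA cb; elim=> [|n IH] x Dx /=.
  by split; [exact: linop_dom0 | exact: linop0].
have [D1 e1] := cb x Dx; have [D2 e2] := IH x Dx; have [D3 e3] := IH _ D2.
have sA := linop_subspace lA.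
split; first by apply: subspaceZ => //; exact: subspaceD.
by rewrite linopZ ?linopD // ?e1 ?e3 ?e2 //; exact: subspaceD.
Qed.

End SquareRoot.

(* The operator a plays the role of |y|. *)
Lemma operator_modulus y : linear y -> (forall x, nm (y x) <= nm x) ->
  (forall x z, rin (y x) z = rin x (y z)) ->
  exists a : H -> H, [/\ linear a, forall x, 0 <= rin (a x) x,
    forall x, a (a x) = y (y x), forall x, a (y x) = y (a x) &
    forall A, linear_op A -> closed_op A -> commutes A y -> commutes A a].
Proof.
move=> ly y1 ysym.
(* With b = 1 - y^2, a solution q of q = (b + q^2) / 2 gives a = 1 - q with a^2 = 1 - b = y^2, and a
   >= 0 because |q x| <= |x|. *)
pose b x := x - y (y x).
have lb : linear b.
  by move=> c u v; rewrite /b !(linfunP _ _ _ ly) scalerBr opprD addrACA.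
have b1 x : nm (b x) <= nm x.
  apply: nm_sqr_le; rewrite /b !rinE.
  rewrite -!(ysym x) (rinC (y (y x)) x) -(ysym x).
  have := y1 (y x); rewrite -(ler_pXn2r (n := 2)) ?nnegrE ?nm_ge0 // !nm_sqr.
  have := rin_ge0 (y x); lra.
have [q qE] := sqrt_iter_tends lb b1.
have q1 x : nm (q x) <= nm x.
  apply: tends_nm_le (qE x) => n; apply: le_trans (sqrt_iter_le b1 _ _) _.
  by rewrite -[leRHS]mul1r ler_wpM2r ?nm_ge0 ?sqrt_bound_le1.
have lq : linear q.
  move=> c u v; apply: tends_unique (qE _) _.
  apply: tends_ext (tendsD (tendsZ c (qE u)) (qE v)) => n.
  by rewrite (linfunP _ _ _ (sqrt_iter_linear lb n)).
have qlip n u v : nm (sqrt_iter b n u - sqrt_iter b n v) <= 1 * nm (u - v).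
  rewrite -(linfunB _ _ (sqrt_iter_linear lb n)).
  by apply: le_trans (sqrt_iter_le b1 _ _) _; rewrite ler_wpM2r ?nm_ge0 ?sqrt_bound_le1.
have qq x : q x = half *: (b x + q (q x)).
  have qs : tends (fun n => sqrt_iter b n.+1 x) (q x).
    move=> e e0; have [N hN] := qE x e e0; exists N => n Nn; apply: hN.
    exact: leqW.
  apply: tends_unique qs _; apply: tendsZ; apply: tendsD; first exact: tends_cst.
  move=> e e0; have e2 : 0 < e / 2 by rewrite divr_gt0.
  have [N hN] := qE x _ e2; have [M hM] := qE (q x) _ e2.
  exists (maxn N M) => n; rewrite geq_max => /andP[Nn Mn].
  apply: le_lt_trans (nm_tri (sqrt_iter b n (q x)) _ _) _.
  rewrite [e]splitr ltrD ?hM //; apply: le_lt_trans (qlip _ _ _) _.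
  by rewrite mul1r hN.
have qq2 x : q x + q x = b x + q (q x).
  by rewrite {1 2}qq -scalerDl halfD scale1r.
pose a x := x - q x.
exists a; split.
- by move=> c u v; rewrite /a (linfunP _ _ _ lq) scalerBr opprD addrACA.
- move=> x; rewrite /a !rinE subr_ge0; apply: le_trans (rin_le _ _) _.
  by rewrite -nm_sqr expr2 ler_wpM2r ?nm_ge0.
- move=> x; rewrite /a (linfunB _ _ lq).
  have -> : x - q x - (q x - q (q x)) = x - (q x + q x) + q (q x).
    by rewrite opprB opprD !addrA addrAC.
  by rewrite qq2 opprD addrA subrK /b opprB addrC subrK.
- move=> x; rewrite /a (linfunB _ _ ly); congr (_ - _).
  have ylip u v : nm (y u - y v) <= 1 * nm (u - v) by rewrite mul1r -(linfunB _ _ ly).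
  apply: tends_unique (qE _) _; apply: tends_ext (tends_lip ler01 ylip (qE x)) => n.
  (* y is viewed as an everywhere defined operator in order to reuse [sqrt_iter_commutes]. *)
  have lop : linear_op (Operator setT y).
    by split=> // c u v _ _; split=> //=; rewrite (linfunP _ _ _ ly).
  suff cb : commutes (Operator setT y) b.
    by have [_ /= ->] := sqrt_iter_commutes lop cb n (I : dom (Operator setT y) x).
  by move=> u _; split=> //=; rewrite /b (linfunB _ _ ly).
- move=> A lA cA cy x Dx; have sA := linop_subspace lA.
  have cb : commutes A b.
    move=> u Du; have [D1 e1] := cy u Du; have [D2 e2] := cy _ D1.
    by split; [exact: subspaceB | rewrite linopB // e2 e1].
  have [Dq eq] : dom A (q x) /\ A (q x) = q (A x).
    apply: (closedop_seq cA _ (qE x)).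
      by move=> n; case: (sqrt_iter_commutes lA cb n Dx).
    apply: tends_ext (qE (A x)) => n.
    by case: (sqrt_iter_commutes lA cb n Dx).
  by split; [exact: subspaceB | rewrite linopB // eq].
Qed.

End OperatorModulus.

(** * Spectral subspaces of the resolvent *)

Section BoundedVectors.
Context {R : realType} {H : hilbertType R}.
Variables A A' : operator H.
Hypothesis np : normal_pair A A'.
Implicit Types (x z u v w : H) (M : set H).

(** The domain condition and the bound for [A'] follow from those for [A] by normality ([red_dom'],
    [red_le']). *)
Definition bounded_reducing M (r : R) := [/\ lsubspace M, 0 <= r &
  forall x, M x -> [/\ dom A x, M (A x), M (A' x) & nm (A x) <= r * nm x]].

Let lA := np_lin np.
Let lA' := np_lin' np.
Let sA := linop_subspace lA.
Let sA' := linop_subspace lA'.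

Definition is_resolvent (T : H -> H) := forall x,
  [/\ dom A (T x), dom A' (A (T x)) & T x + A' (A (T x)) = x].

Lemma resolvent_exists : exists T, is_resolvent T.
Proof.
by have [T hT] := choice (fun x => resolvent x np); exists T.
Qed.

Section Resolvent.
Variable T : H -> H.
Hypothesis hT : is_resolvent T.

Let DT x : dom A (T x). Proof. by case: (hT x). Qed.
Let DAT x : dom A' (A (T x)). Proof. by case: (hT x). Qed.
Let TE x : T x + A' (A (T x)) = x. Proof. by case: (hT x). Qed.
Let AAT x : A' (A (T x)) = x - T x.
Proof. by rewrite -{2}(TE x) addrC addKr. Qed.

(** A difference d of two solutions satisfies |d|^2 + |A d|^2 = 0. Linearity and commutation of T
    are deduced from this uniqueness. *)
Lemma resolvent_unique u x : dom A u -> dom A' (A u) -> u + A' (A u) = x -> u = T x.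
Proof.
move=> Du DAu e; apply/eqP; rewrite -subr_eq0; apply/eqP.
set d := u - T x; have Dd : dom A d by exact: subspaceB.
have Ad : A d = A u - A (T x) by rewrite linopB.
have DAd : dom A' (A d) by rewrite Ad; exact: subspaceB.
have e0 : d + A' (A d) = 0.
  rewrite Ad linopB // /d addrACA -opprD e TE; exact: subrr.
have h : inner d d + inner (A d) (A d) = 0 :> R[i].
  by rewrite [X in _ + X](np_inner np) // -inDr e0 in0r.
apply: rin_le0; have := congr1 (@complex.Re R) h; rewrite ReD /= -/(rin _ _).
have := rin_ge0 (A d); rewrite {1}/rin; lra.
Qed.

Lemma resolvent_linear : linear T.
Proof.
move=> a x y; apply/esym/resolvent_unique; first exact: (proj2 sA).
  by rewrite linopP //; apply: (proj2 sA').
by rewrite !linopP // addrACA -scalerDr !TE.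
Qed.

(** Source of T^2 <= T <= 1, and of the bound on A in [resolvent_cutoff]. *)
Lemma resolvent_form x : rin (T x) x = rin (T x) (T x) + rin (A (T x)) (A (T x)).
Proof.
by rewrite -{2}(TE x) rinDr; congr (_ + _); rewrite /rin -(np_inner np).
Qed.

Lemma resolvent_sym x z : rin (T x) z = rin x (T z).
Proof.
rewrite -{1}(TE z) rinDr -{3}(TE x) rinDl; congr (_ + _).
by rewrite /rin -(np_inner np) // [inner (A' _) _]inC ReJ -(np_inner np) // inC ReJ.
Qed.

Lemma resolvent_sqr_le x : rin (T x) (T x) <= rin (T x) x.
Proof. by rewrite resolvent_form lerDl rin_ge0. Qed.

Lemma resolvent_form_le x : rin (T x) x <= rin x x.
Proof.
have h := rin_le (T x) x; have h2 := resolvent_sqr_le x.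
have [t0|t0] := eqVneq (nm (T x)) 0.
  by rewrite (nm_eq0 t0) rin0l rin_ge0.
have tp : 0 < nm (T x) by rewrite lt_def t0 nm_ge0.
have : nm (T x) <= nm x.
  rewrite -(ler_pM2l tp) -expr2 nm_sqr; exact: le_trans h.
move=> h3; apply: le_trans h _; rewrite -nm_sqr expr2 ler_wpM2r ?nm_ge0 //.
Qed.

Lemma resolvent_inj x : T x = 0 -> x = 0.
Proof. by move=> h; rewrite -(TE x) h linop0 // linop0 // addr0. Qed.

(** For x in the domain of A, A' A T x = x - T x is in it too, so normality applies to A T x and
    gives (1 + A' A) A T x = A x. *)
Lemma resolvent_commutes : commutes A T.
Proof.
move=> x Dx; split=> //; apply: resolvent_unique.
- have : dom A (A' (A (T x))) by rewrite AAT; exact: subspaceB.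
  by case/(np_comm' np (DAT x)).
- have D1 : dom A (A' (A (T x))) by rewrite AAT; exact: subspaceB.
  by have [] := np_comm' np (DAT x) D1.
- have D1 : dom A (A' (A (T x))) by rewrite AAT; exact: subspaceB.
  have [D2 D3 e] := np_comm' np (DAT x) D1.
  by rewrite e AAT linopB // addrC subrK.
Qed.

Lemma resolvent_commutes' : commutes A' T.
Proof.
move=> x Dx; split; first exact/(np_domE _ np).
have [D1 D2 e] := np_comm np (DT x) (DAT x).
have D3 : dom A' (A (A' (T x))).
  by rewrite e AAT; exact: subspaceB.
apply: resolvent_unique => //.
by rewrite e AAT linopB // addrC subrK.
Qed.

(* M = ker (|y| - y) with y = T - eps is the spectral subspace of T for the interval
   [eps, 1]; there 1 - T has norm less than 1, so T is invertible on M by a Neumann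
   series, whence M lies in the domain of A'A. *)
Lemma resolvent_cutoff (eps : R) : 0 < eps -> eps <= 2^-1 ->
  exists2 M, bounded_reducing M eps^-1 &
    forall z, (forall x, M x -> inner z x = 0 :> R[i]) -> rin (T z) z <= eps * rin z z.
Proof.
move=> e0 e2.
pose y x := T x - eps%:C%C *: x.
have lT := resolvent_linear.
have ly : linear y.
  move=> a u v; rewrite /y (linfunP _ _ _ lT) scalerDr scalerA mulrC -scalerA.
  by rewrite opprD addrACA -scalerBr.
(* Here eps <= 1/2 keeps the coefficient 1 - 2 eps of <T x, x> nonnegative, so that <T x, x> <=
   |x|^2 can be inserted. *)
have y1 x : nm (y x) <= nm x.
  apply: nm_sqr_le; rewrite /y !rinE -!mulrN (rinC x (T x)).
  have h1 := resolvent_sqr_le x; have h2 := resolvent_form_le x.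
  have h3 : 0 <= (1 - 2 * eps) * (rin x x - rin (T x) x) by rewrite mulr_ge0 //; lra.
  have h4 : 0 <= (2 * eps - eps ^+ 2) * rin x x.
    rewrite mulr_ge0 ?rin_ge0 //.
    have : 0 <= eps * (2 - eps) by rewrite mulr_ge0 //; lra.
    by rewrite expr2; lra.
  have h5 : rin (T x) (T x) - eps * rin (T x) x
     + (eps * - rin (T x) x + eps * (eps * rin x x)) <=
     rin x x - (1 - 2 * eps) * (rin x x - rin (T x) x) - (2 * eps - eps ^+ 2) * rin x x.
    by lra.
  move: h3 h4 h5; lra.
have ysym x z : rin (y x) z = rin x (y z).
  by rewrite /y !rinE resolvent_sym.
have cy : commutes A y.
  move=> x Dx; have [D1 e1] := resolvent_commutes Dx.
  have D2 : dom A (eps%:C%C *: x) by exact: subspaceZ.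
  by split; [exact: subspaceB | rewrite linopB // linopZ // e1].
have cy' : commutes A' y.
  move=> x Dx; have [D1 e1] := resolvent_commutes' Dx.
  have D2 : dom A' (eps%:C%C *: x) by exact: subspaceZ.
  by split; [exact: subspaceB | rewrite linopB // linopZ // e1].
have [a [la apos aa ay ca]] := operator_modulus ly y1 ysym.
pose M : set H := [set x | a x = y x].
have TyE x : T x = y x + eps%:C%C *: x by rewrite subrK.
have aT x : a (T x) = T (a x).
  by rewrite TyE linfunD // linfunZ // ay -TyE.
have yT x : y (T x) = T (y x) by rewrite /y (linfunB _ _ lT) (linfunZ _ _ lT).
(* This places the limit v of the Neumann series in M through T v = x, instead of through closedness
   of M. *)
have MT v : M (T v) -> M v.
  move=> h; apply/eqP; rewrite -subr_eq0; apply/eqP/resolvent_inj.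
  by rewrite (linfunB _ _ lT) -aT -yT h subrr.
have sM : lsubspace M.
  split; first by rewrite /M /= !linfun0.
  by move=> c u v Mu Mv; rewrite /M /= (linfunP _ _ _ la) (linfunP _ _ _ ly) Mu Mv.
have Mpos x : M x -> eps * rin x x <= rin (T x) x.
  move=> Mx; have := apos x; rewrite Mx /y !rinE; lra.
pose Q x := x - T x.
have MQ x : M x -> M (Q x).
  move=> Mx; apply: subspaceB => //; rewrite /M /= aT yT; congr T; exact: Mx.
have lQ : linear Q.
  by move=> c u v; rewrite /Q (linfunP _ _ _ lT) scalerBr opprD addrACA.
(* On M, |Q x|^2 <= (1 - eps) |x|^2, and 1 - eps <= (1 - eps / 2)^2 avoids a square root. *)
pose k : R := 1 - eps / 2.
have k0 : 0 <= k by rewrite /k; lra.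
have k1 : k < 1 by rewrite /k; lra.
have Qk x : M x -> nm (Q x) <= k * nm x.
  move=> Mx; rewrite -(ler_pXn2r (n := 2)) ?nnegrE ?mulr_ge0 ?nm_ge0 //.
  rewrite exprMn !nm_sqr /Q !rinE (rinC x (T x)).
  have h1 := resolvent_sqr_le x; have h2 := Mpos x Mx.
  have h3 : (1 - eps) * rin x x <= k ^+ 2 * rin x x.
    by rewrite ler_wpM2r ?rin_ge0 // /k; have := sqr_ge0 eps; lra.
  move: h3; lra.
have surj x : M x -> exists2 v, M v & T v = x.
  move=> Mx; pose vs (n : nat) := iter n (fun v => x + Q v) 0.
  have dvs n : vs n.+1 - vs n = iter n Q x /\ M (iter n Q x).
    elim: n => [|n [IH IM]].
      by rewrite /vs /= subr0 (linfun0 lQ) addr0.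
    split; last exact: MQ.
    rewrite [vs n.+2]/(x + Q (vs n.+1)) [X in _ - X]/(x + Q (vs n)).
    by rewrite opprD addrACA subrr add0r -(linfunB _ _ lQ) IH.
  have nQ n : nm (iter n Q x) <= k ^+ n * nm x.
    elim: n => [|n IH]; first by rewrite expr0 mul1r.
    apply: le_trans (Qk _ (proj2 (dvs n))) _.
    by rewrite exprS -mulrA ler_wpM2l.
  have [v vE] : exists v, tends vs v.
    apply: cauchyseq_tends.
    apply: (@increasing_cauchyseq R H (fun n => nm x * (1 - k ^+ n) / (1 - k)) (nm x / (1 - k))) => n.
      rewrite ler_pM2r ?invr_gt0 ?subr_gt0 // ler_piMr ?nm_ge0 // gerBl.
      exact: exprn_ge0.
    rewrite (proj1 (dvs n)); apply: le_trans (nQ n) _.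
    rewrite exprS le_eqVlt; apply/orP; left; apply/eqP.
    by field; rewrite gt_eqF // subr_gt0.
  have Qlip s t : nm (Q s - Q t) <= 2 * nm (s - t).
    rewrite -(linfunB _ _ lQ) /Q; apply: le_trans (nmB _ _) _.
    rewrite mulrDl mul1r lerD // nm_sqr_le //.
    exact: le_trans (resolvent_sqr_le _) (resolvent_form_le _).
  have v1 : tends (fun n => vs n.+1) v.
    move=> e ep; have [N hN] := vE e ep; exists N => n Nn; apply: hN; exact: leqW.
  have vQ : v = x + Q v.
    apply: tends_unique v1 _; apply: tendsD; first exact: tends_cst.
    by apply: tends_lip Qlip vE.
  have Tv : T v = x.
    move/eqP: vQ; rewrite /Q addrCA -subr_eq0 opprD addrA subrr sub0r oppr_eq0.
    by rewrite subr_eq0 => /eqP.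
  by exists v => //; apply: MT; rewrite Tv.
exists M.
  split=> //; first by rewrite invr_ge0 ltW.
  move=> x Mx; have [v Mv Tv] := surj x Mx; have Dx : dom A x by rewrite -Tv.
  have Dx' : dom A' x by apply/(np_domE _ np).
  split=> //.
  - have [_ h1] := ca A lA (np_closed np) cy x Dx; have [_ h2] := cy x Dx.
    by rewrite /M /= -h1 -h2 Mx.
  - have [_ h1] := ca A' lA' (np_closed' np) cy' x Dx'; have [_ h2] := cy' x Dx'.
    by rewrite /M /= -h1 -h2 Mx.
  (* From eps |v|^2 <= <T v, v> <= |x| |v| one gets |v| <= |x| / eps; then |A x|^2 <= <T v, v> <=
     |x|^2 / eps, and 1 / eps >= 1. *)
  have hv := Mpos v Mv; have hf := rin_le (T v) v; rewrite -nm_sqr in hv.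
  have nv : nm v <= eps^-1 * nm x.
    rewrite mulrC ler_pdivlMr // mulrC.
    have [->|v0] := eqVneq (nm v) 0; first by rewrite mulr0 nm_ge0.
    have vp : 0 < nm v by rewrite lt_def v0 nm_ge0.
    rewrite -(ler_pM2r vp) -mulrA -expr2 -Tv; exact: le_trans hf.
  rewrite -(ler_pXn2r (n := 2)) ?nnegrE ?mulr_ge0 ?nm_ge0 ?invr_ge0 ?(ltW e0) //.
  have hA : nm (A x) ^+ 2 <= rin (T v) v.
    by rewrite nm_sqr resolvent_form Tv lerDr rin_ge0.
  apply: le_trans hA _; apply: le_trans hf _; rewrite Tv expr2.
  apply: ler_pM; rewrite ?nm_ge0 // ler_peMl ?nm_ge0 // invf_ge1 //; lra.
move=> z hz.
(* Since (a - y) (a + y) = a^2 - y^2 = 0, the range of a + y lies in M. For z orthogonal to M this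
   gives <y z, z> = - <a z, z> <= 0. *)
have Mz : M (a z + y z).
  by rewrite /M /= (linfunD _ _ la) (linfunD _ _ ly) aa ay addrC.
have := hz _ Mz => /(congr1 (@complex.Re R)); rewrite /= -/(rin _ _) rinDr.
rewrite (rinC z (a z)) (rinC z (y z)) /y !rinE; have := apos z; lra.
Qed.

End Resolvent.

(** By the cutoffs, |T z|^2 <= <T z, z> <= eps |z|^2 for all small eps, so T z = 0, and T is
    injective. *)
Lemma bounded_reducing_total z :
  (forall M r, bounded_reducing M r -> forall x, M x -> inner z x = 0 :> R[i]) -> z = 0.
Proof.
move=> hz; have [T hT] := resolvent_exists.
apply: (resolvent_inj hT); apply: rin_le0.
apply: le_trans (resolvent_sqr_le hT z) _; apply/ler_addgt0Pr => e e0; rewrite add0r.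
pose K := rin z z + 1; have K0 : 0 < K by rewrite ltr_wpDl // rin_ge0.
pose d := Num.min (2^-1) (e / K).
have d0 : 0 < d by rewrite lt_min divr_gt0 // invr_gt0 ltr0n.
have [||M rM hM] := @resolvent_cutoff T hT d => //; first by rewrite ge_min lexx.
apply: le_trans (hM z (hz _ _ rM)) _.
apply: (@le_trans _ _ (e / K * rin z z)).
  by rewrite ler_wpM2r ?rin_ge0 // ge_min lexx orbT.
by rewrite -mulrA ler_piMr ?(ltW e0) // mulrC ler_pdivrMr // mul1r lerDl ler01.
Qed.

End BoundedVectors.

(** * Fuglede's theorem *)

Section Liouville.
Context {R : realType}.
Implicit Types (p : {poly R[i]}) (t : R[i]) (rho K : R).

Lemma cabs_sqrt t rho : 0 <= rho -> cabs t = rho ^+ 2 ->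
  exists2 u, u ^+ 2 = t & cabs u = rho.
Proof.
move=> r0 ht; exists (sqrtC t); first exact: sqrtCK.
apply/eqP; rewrite -(eqrXn2 (n := 2)) ?cabs_ge0 //.
by rewrite -cabsX sqrtCK ht.
Qed.

Lemma poly_even_odd_eval p t :
  p.[t] = (even_poly p).[t ^+ 2] + (odd_poly p).[t ^+ 2] * t.
Proof.
by rewrite -{1}(poly_even_odd p) !hornerE !horner_comp !hornerE.
Qed.

(* Averaging over the two square roots of a point halves the degree and keeps both
   the value at 0 and the bound. *)
Lemma coef0_le_sup p rho K : 0 <= rho ->
  (forall t, cabs t = rho -> cabs p.[t] <= K) -> cabs p`_0 <= K.
Proof.
have [n] := ubnP (size p); elim: n p rho => // n IH p rho sp r0 hp.
have [sp1|sp1] := leqP (size p) 1.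
  have := hp rho%:C%C; rewrite cabs_real ger0_norm // (size1_polyC sp1) hornerC coefC /=.
  exact.
have -> : p`_0 = (even_poly p)`_0 by rewrite coef_even_poly.
apply: (IH _ (rho ^+ 2)); last 2 first.
- exact: sqr_ge0.
- move=> s /(cabs_sqrt r0)[t <- ht].
  have -> : (even_poly p).[t ^+ 2] = 2^-1 * (p.[t] + p.[- t]).
    rewrite !(poly_even_odd_eval p) sqrrN mulrN; by field.
  rewrite cabsM cabsV cabs_nat ler_pdivrMl ?ltr0n //.
  apply: le_trans (cabsD _ _) _; rewrite mulr2n mulrDl mul1r lerD ?hp //.
  by rewrite cabsN.
apply: leq_ltn_trans (size_even_poly _) _.
move: sp sp1; case: (size p) => [|[|m]] //= sp _.
rewrite ltnS in sp; apply: leq_trans sp.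
by rewrite !ltnS leq_uphalf_double -addnn leq_addr.
Qed.

(** The coefficient is the constant term of (p(t) - p(-t)) / (2 t), a polynomial in t^2; the
    division by t produces the factor rho. *)
Lemma coef1_le_sup p rho K : 0 < rho ->
  (forall t, cabs t = rho -> cabs p.[t] <= K) -> cabs p`_1 * rho <= K.
Proof.
move=> r0 hp; rewrite -ler_pdivlMr //.
have -> : p`_1 = (odd_poly p)`_0 by rewrite coef_odd_poly.
apply: (@coef0_le_sup _ (rho ^+ 2)); first exact: sqr_ge0.
move=> s /(cabs_sqrt (ltW r0))[t <- ht].
have t0 : t != 0 by apply/eqP => t0; move: r0; rewrite -ht t0 cabs0 ltxx.
have -> : (odd_poly p).[t ^+ 2] = 2^-1 * (p.[t] - p.[- t]) * t^-1.
  rewrite !(poly_even_odd_eval p) sqrrN mulrN; by field; rewrite ?t0.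
rewrite !cabsM !cabsV cabs_nat ht ler_pM2r ?invr_gt0 // ler_pdivrMl ?ltr0n //.
apply: le_trans (cabsD _ _) _; rewrite cabsN mulr2n mulrDl mul1r lerD ?hp //.
by rewrite cabsN.
Qed.

Lemma one_plus_exp_le (a : R) (n : nat) : 0 <= a -> (0 < n)%N -> (1 + a / n%:R) ^+ n <= expR a.
Proof.
move=> a0 n0; have -> : expR a = expR (a / n%:R) ^+ n.
  by rewrite -expRM_natl mulrC divfK // pnatr_eq0 -lt0n.
by rewrite lerXn2r ?nnegrE ?expR_ge0 ?expR_ge1Dx // addr_ge0 // divr_ge0.
Qed.

(** The excess 1 / (E + 1) over 1 stays below 1 after multiplication by E. With n above a^2 (E + 2),
    the power is at most exp(1 / (E + 2)), and exp(- u) >= 1 - u turns this into (E + 2) / (E +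
    1). *)
Lemma one_plus_sqr_exp (a E : R) : 0 <= a -> 0 <= E ->
  exists2 n : nat, (0 < n)%N & (1 + (a / n%:R) ^+ 2) ^+ n <= 1 + (E + 1)^-1.
Proof.
move=> a0 E0; pose n := (Num.bound (a ^+ 2 * (E + 2))).+1.
have n0 : (0 : R) < n%:R by rewrite ltr0n.
have E2 : 0 < E + 2 by lra.
have E1 : 0 < E + 1 by lra.
exists n => //.
have -> : (a / n%:R) ^+ 2 = (a ^+ 2 / n%:R) / n%:R by rewrite expr_div_n expr2 invfM mulrA.
apply: le_trans (one_plus_exp_le _ _) _ => //; first by rewrite divr_ge0 ?sqr_ge0 ?ltW.
set u := a ^+ 2 / n%:R.
have hu : u <= (E + 2)^-1.
  rewrite /u ler_pdivrMr // mulrC ler_pdivlMr //.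
  apply: ltW; apply: lt_le_trans (archi_boundP _) _; first by rewrite mulr_ge0 ?sqr_ge0 // ltW.
  by rewrite ler_nat.
have hE : 1 - (E + 2)^-1 = (E + 1) / (E + 2) by field; rewrite gt_eqF.
have h1 : 0 < 1 - (E + 2)^-1 by rewrite hE divr_gt0.
have -> : 1 + (E + 1)^-1 = ((E + 1) / (E + 2))^-1 by field; rewrite !gt_eqF.
rewrite -[expR u]invrK -expRN -hE lef_pV2 ?posrE ?expR_gt0 //.
apply: le_trans (expR_ge1Dx _); lra.
Qed.

End Liouville.

(** * Powers of 1 + c A on a reducing subspace *)

Section Fuglede.
Context {R : realType} {H : hilbertType R}.
Implicit Types (A : operator H) (x y u v w : H) (M : set H) (c t : R[i]).

Lemma iter_stable (M : set H) (f : H -> H) n x :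
  (forall x, M x -> M (f x)) -> M x -> M (iter n f x).
Proof. by move=> fM Mx; elim: n => //= n IH; exact: fM. Qed.

Lemma iter_swap (M : set H) (f g : H -> H) n x :
  (forall x, M x -> M (f x)) ->
  (forall x, M x -> g (f x) = f (g x)) -> M x ->
  g (iter n f x) = iter n f (g x).
Proof.
move=> fM fg Mx; elim: n => //= n IH.
by rewrite fg ?IH //; exact: iter_stable.
Qed.

Lemma iter_comp (M : set H) (f g : H -> H) n x :
  (forall x, M x -> M (f x)) -> (forall x, M x -> M (g x)) ->
  (forall x, M x -> g (f x) = f (g x)) -> M x ->
  iter n (fun z => f (g z)) x = iter n f (iter n g x).
Proof.
move=> fM gM fg Mx; elim: n => // n IH.
rewrite iterS IH [iter n.+1 g x]iterS iterS; congr f.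
apply: (iter_swap (M := M)) => //; exact: iter_stable.
Qed.

Definition pert A c x := x + c *: A x.

Section Pair.
Variables A A' : operator H.
Hypothesis np : normal_pair A A'.
Variables (M : set H) (r : R).
Hypothesis rM : bounded_reducing A A' M r.

Let lA := np_lin np.
Let lA' := np_lin' np.
Let sM : lsubspace M. Proof. by case: rM. Qed.
Let r0 : 0 <= r. Proof. by case: rM. Qed.

Lemma red_dom x : M x -> dom A x.
Proof. by case: rM => _ _ h /h[]. Qed.
Lemma red_dom' x : M x -> dom A' x.
Proof. by move/red_dom => Dx; apply/(np_domE _ np). Qed.
Lemma red_stable x : M x -> M (A x).
Proof. by case: rM => _ _ h /h[]. Qed.
Lemma red_stable' x : M x -> M (A' x).
Proof. by case: rM => _ _ h /h[]. Qed.
Lemma red_le x : M x -> nm (A x) <= r * nm x.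
Proof. by case: rM => _ _ h /h[]. Qed.
Lemma red_le' x : M x -> nm (A' x) <= r * nm x.
Proof. by move=> Mx; rewrite (np_nm np) ?red_le //; exact: red_dom. Qed.
Lemma red_comm x : M x -> A (A' x) = A' (A x).
Proof.
by move=> Mx; have [] := np_comm np (red_dom Mx) (red_dom' (red_stable Mx)).
Qed.

Lemma red_sym : bounded_reducing A' A M r.
Proof.
split=> // x Mx; split; [exact: red_dom' | exact: red_stable' | exact: red_stable|].
exact: red_le'.
Qed.

Lemma pert_stable c x : M x -> M (pert A c x).
Proof. by move=> Mx; apply: subspaceD => //; apply: subspaceZ => //; exact: red_stable. Qed.
Lemma pert_stable' c x : M x -> M (pert A' c x).
Proof. by move=> Mx; apply: subspaceD => //; apply: subspaceZ => //; exact: red_stable'. Qed.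

Lemma pert_le c x : M x -> nm (pert A c x) <= (1 + cabs c * r) * nm x.
Proof.
move=> Mx; apply: le_trans (nmD _ _) _; rewrite mulrDl mul1r lerD // nmZ -mulrA.
by rewrite ler_wpM2l ?cabs_ge0 // red_le.
Qed.

Lemma iter_pert_le c n x : M x ->
  nm (iter n (pert A c) x) <= (1 + cabs c * r) ^+ n * nm x.
Proof.
move=> Mx; elim: n => [|n IH]; first by rewrite expr0 mul1r.
rewrite iterS; apply: le_trans (pert_le _ _) _.
  by apply: iter_stable => //; exact: pert_stable.
by rewrite exprS -mulrA ler_wpM2l // addr_ge0 // mulr_ge0 ?cabs_ge0.
Qed.

Lemma pert_inner c x y : dom A x -> dom A' y ->
  inner (pert A c x) y = inner x (pert A' (Num.conj c) y) :> R[i].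
Proof. by move=> Dx Dy; rewrite inDl inZl (np_inner np) // inDr inZr conjCK. Qed.

Lemma pert_swap c d x : M x -> pert A c (pert A' d x) = pert A' d (pert A c x).
Proof.
move=> Mx; have D1 := red_dom Mx; have D2 := red_dom (red_stable' Mx).
have D1' := red_dom' Mx; have D2' := red_dom' (red_stable Mx).
have D3 : dom A (d *: A' x) by apply: subspaceZ => //; exact: linop_subspace.
have D3' : dom A' (c *: A x) by apply: subspaceZ => //; exact: linop_subspace.
rewrite /pert (linopD lA) // (linopZ lA) // (linopD lA') // (linopZ lA') // red_comm //.
rewrite !scalerDr !scalerA [c * d]mulrC !addrA; congr (_ + _).
by rewrite -!addrA; congr (_ + _); rewrite addrC.
Qed.

Lemma pert_self_swap c d x : M x -> pert A c (pert A d x) = pert A d (pert A c x).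
Proof.
move=> Mx; have D1 := red_dom Mx; have D2 := red_dom (red_stable Mx).
have sA := linop_subspace lA.
have D3 : dom A (c *: A x) by exact: subspaceZ.
have D4 : dom A (d *: A x) by exact: subspaceZ.
rewrite /pert !(linopD lA) // !(linopZ lA) //.
rewrite !scalerDr !scalerA [c * d]mulrC !addrA; congr (_ + _).
by rewrite -!addrA; congr (_ + _); rewrite addrC.
Qed.

(** The terms linear in c cancel; for c of order 1 / n this keeps the n-th powers close to the
    identity. *)
Lemma pert_square c x : M x -> pert A c (pert A (- c) x) = x - c ^+ 2 *: A (A x).
Proof.
move=> Mx; have D1 := red_dom Mx; have D2 := red_dom (red_stable Mx).
have sA := linop_subspace lA.
have D4 : dom A (- c *: A x) by exact: subspaceZ.
rewrite /pert (linopD lA) // (linopZ lA) //.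
by rewrite scalerDr scalerA mulrN -expr2 !scaleNr addrA subrK.
Qed.

Lemma pert_square_le c x : M x ->
  nm (pert A c (pert A (- c) x)) <= (1 + (cabs c * r) ^+ 2) * nm x.
Proof.
move=> Mx; rewrite pert_square //; apply: le_trans (nmB _ _) _.
rewrite mulrDl mul1r lerD // nmZ cabsX exprMn -!mulrA.
rewrite !ler_wpM2l ?cabs_ge0 //.
apply: le_trans (red_le (red_stable Mx)) _.
by rewrite ler_wpM2l // red_le.
Qed.

Lemma iter_pert_square_near c n x : M x ->
  nm (iter n (fun z => pert A c (pert A (- c) z)) x - x) <=
  ((1 + (cabs c * r) ^+ 2) ^+ n - 1) * nm x.
Proof.
move=> Mx; set K := fun z => _; set q := (cabs c * r) ^+ 2.
have q0 : 0 <= q by rewrite exprn_ge0 // mulr_ge0 ?cabs_ge0.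
have MK z : M z -> M (K z) by move=> Mz; do 2!apply: pert_stable.
have nK n' : nm (iter n' K x) <= (1 + q) ^+ n' * nm x.
  elim: n' => [|m IH]; first by rewrite expr0 mul1r.
  rewrite iterS; apply: le_trans (pert_square_le _ _) _; first exact: iter_stable.
  by rewrite -/q [(1 + q) ^+ m.+1]exprS -[leRHS]mulrA ler_wpM2l // addr_ge0.
elim: n => [|n IH]; first by rewrite expr0 !subrr mul0r nm0.
rewrite iterS {1}/K pert_square; last exact: iter_stable.
rewrite addrAC; apply: le_trans (nmB _ _) _.
set z := iter n K x; have Mz : M z by exact: iter_stable.
have h : nm (c ^+ 2 *: A (A z)) <= q * nm z.
  rewrite nmZ cabsX /q exprMn -!mulrA !ler_wpM2l ?cabs_ge0 //.
  apply: le_trans (red_le (red_stable Mz)) _.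
  by rewrite ler_wpM2l // red_le.
have h2 : q * nm z <= q * ((1 + q) ^+ n * nm x) by rewrite ler_wpM2l // nK.
have -> : ((1 + q) ^+ n.+1 - 1) * nm x = ((1 + q) ^+ n - 1) * nm x + q * ((1 + q) ^+ n * nm x).
  by rewrite [(1 + q) ^+ n.+1]exprS; ring.
by rewrite lerD // (le_trans h).
Qed.

End Pair.

End Fuglede.

Section FugledeBounded.
Context {R : realType} {H : hilbertType R}.
Implicit Types (x y u v w : H) (M : set H) (c t : R[i]).

Lemma linfun_sum (f : H -> H) n (F : 'I_n -> H) : linear f ->
  f (\sum_(i < n) F i) = \sum_(i < n) f (F i).
Proof.
by move=> lf; apply: (big_morph f) => [a b|]; [exact: linfunD | exact: linfun0].
Qed.

Lemma linop_sum (A : operator H) n (F : 'I_n -> H) : linear_op A ->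
  (forall i, dom A (F i)) ->
  dom A (\sum_(i < n) F i) /\ A (\sum_(i < n) F i) = \sum_(i < n) A (F i).
Proof.
move=> lA DF; apply: (big_ind2 (fun a b => dom A a /\ A a = b)) => //.
- by split; [exact: linop_dom0 | exact: linop0].
- move=> a b a' b' [D1 <-] [D2 <-]; split; last exact: linopD.
  by apply: subspaceD => //; exact: linop_subspace.
Qed.

Lemma iter_iter_swap (M : set H) (f g : H -> H) m n x :
  (forall x, M x -> M (f x)) -> (forall x, M x -> M (g x)) ->
  (forall x, M x -> g (f x) = f (g x)) -> M x ->
  iter m g (iter n f x) = iter n f (iter m g x).
Proof.
move=> fM gM fg Mx; elim: m => // m IH.
by rewrite iterS IH (iter_swap (M := M)) //; exact: iter_stable.
Qed.

Variables A A' : operator H.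
Hypothesis np : normal_pair A A'.

(** By normality the squared norm is <x, (1 - c^2 A^2) (1 - conj(c)^2 A'^2) x>: the four factors
    regroup into pairs whose linear terms cancel. *)
Lemma gauge_le M r c x : bounded_reducing A A' M r -> M x ->
  nm (pert A (- c) (pert A' (Num.conj c) x)) <= (1 + (cabs c * r) ^+ 2) * nm x.
Proof.
move=> rM Mx; have r0 : 0 <= r by case: rM.
have rM' := red_sym np rM.
set w := pert A _ _; set q := (cabs c * r) ^+ 2.
have q0 : 0 <= q by rewrite exprn_ge0 // mulr_ge0 ?cabs_ge0.
set d := Num.conj c in w *.
have M1 : M (pert A' d x) by exact: (pert_stable' rM).
have Mw : M w by exact: (pert_stable rM).
have M3 : M (pert A' (- d) (pert A' d x)) by exact: (pert_stable' rM).
have E : inner w w = inner x (pert A c (pert A (- c) (pert A' d (pert A' (- d) x)))) :> R[i].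
  have Mz : M (pert A' (- d) w) by exact: (pert_stable' rM).
  rewrite {1}/w (pert_inner np _ (red_dom rM M1) (red_dom' np rM Mw)) rmorphN -/d.
  rewrite (pert_inner (np_sym np) _ (red_dom' np rM Mx) (red_dom rM Mz)).
  rewrite conjCK /w -(pert_swap np rM) //; congr (inner x (pert A c (pert A (- c) _))).
  exact: (pert_self_swap (np_sym np) rM').
rewrite -(ler_pXn2r (n := 2)) ?nnegrE ?mulr_ge0 ?nm_ge0 ?addr_ge0 //.
rewrite nm_sqr /rin E -/(rin _ _); apply: le_trans (rin_le _ _) _.
have h1 : nm (pert A' d (pert A' (- d) x)) <= (1 + q) * nm x.
  by have := pert_square_le (np_sym np) rM' d Mx; rewrite cabsJ.
have M4 : M (pert A' d (pert A' (- d) x)) by do 2!apply: (pert_stable' rM).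
have h2 := pert_square_le np rM c M4.
rewrite exprMn expr2 expr2 mulrC mulrA ler_wpM2r ?nm_ge0 //.
apply: le_trans h2 _.
by rewrite -/q -mulrA ler_wpM2l // addr_ge0.
Qed.

(* ((1 - c A)(1 + conj(c) A'))^n approximates the unitary operator
   exp (n (conj(c) A' - c A)). *)
Definition gauge c x := pert A (- c) (pert A' (Num.conj c) x).

Lemma gauge_stable M r c x : bounded_reducing A A' M r -> M x -> M (gauge c x).
Proof. by move=> rM Mx; apply: (pert_stable rM); exact: (pert_stable' rM). Qed.

Lemma iter_gauge_le M r c n x : bounded_reducing A A' M r -> M x ->
  nm (iter n (gauge c) x) <= (1 + (cabs c * r) ^+ 2) ^+ n * nm x.
Proof.
move=> rM Mx; have q0 : 0 <= (cabs c * r) ^+ 2 by exact: sqr_ge0.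
elim: n => [|n IH]; first by rewrite expr0 mul1r.
rewrite iterS; apply: le_trans (gauge_le c rM _) _.
  by apply: iter_stable => // z; exact: gauge_stable rM.
by rewrite [in leRHS]exprS -[leRHS]mulrA ler_wpM2l // addr_ge0.
Qed.

Section Commutant.
Variables (S : H -> H) (s : R).
Hypotheses (lS : linear S) (s0 : 0 <= s) (Sle : forall x, nm (S x) <= s * nm x).
Hypothesis cS : commutes A S.

Lemma pert_commutes c x : dom A x -> dom A (S x) /\ pert A c (S x) = S (pert A c x).
Proof.
move=> Dx; have [D1 e1] := cS Dx; split=> //.
by rewrite /pert e1 (linfunD _ _ lS) (linfunZ _ _ lS).
Qed.

Lemma iter_pert_inner M N r c n x y :
  bounded_reducing A A' M r -> bounded_reducing A A' N r -> M x -> N y ->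
  inner (iter n (pert A' (Num.conj c)) x) (S y) = inner x (S (iter n (pert A c) y)) :> R[i].
Proof.
move=> rM rN Mx; elim: n y => // n IH y Ny.
have [D1 e1] := pert_commutes c (red_dom rN Ny).
rewrite iterS (pert_inner (np_sym np)) //; last first.
  apply: (red_dom' np rM); apply: iter_stable => // z; exact: (pert_stable' rM).
rewrite conjCK e1 IH; last exact: (pert_stable rN).
by rewrite -iterSr.
Qed.

(* Since S commutes with A, replacing both arguments by iterates of [gauge c] only
   inserts ((1 + c A)(1 - c A))^n = (1 - c^2 A^2)^n, which is close to 1 when
   n |c|^2 is small. *)
Lemma pert_form_le M N r c n x y :
  bounded_reducing A A' M r -> bounded_reducing A A' N r -> M x -> N y ->
  cabs (inner (iter n (pert A (- c)) x) (S (iter n (pert A' (Num.conj c)) y))) <=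
  s * (((1 + (cabs c * r) ^+ 2) ^+ n) ^+ 2 +
       ((1 + (cabs c * r) ^+ 2) ^+ n - 1) * ((1 + cabs c * r) ^+ n) ^+ 2) * (nm x * nm y).
Proof.
move=> rM rN Mx Ny; set q := (cabs c * r) ^+ 2.
have r0 : 0 <= r by case: rM.
set X := iter n _ x; set Y := iter n _ y.
have MX : M X by apply: iter_stable => // z; exact: (pert_stable rM).
have NY : N Y by apply: iter_stable => // z; exact: (pert_stable' rN).
pose K z := pert A c (pert A (- c) z).
(* The left vector is (1 + conj(c) A')^n X. The adjoint (1 + c A)^n of this power passes through S
   and meets the (1 - c A)^n contained in the right one. *)
have E : inner (iter n (gauge c) x) (S (iter n (gauge c) y)) =
    inner X (S (iter n K Y)) :> R[i].
  have sA := @pert_stable _ _ _ _ _ _ rM (- c).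
  have sA' := @pert_stable' _ _ _ _ _ _ rM (Num.conj c).
  have tA := @pert_stable _ _ _ _ _ _ rN (- c).
  have tA' := @pert_stable' _ _ _ _ _ _ rN (Num.conj c).
  have sw z : M z -> pert A' (Num.conj c) (pert A (- c) z) = pert A (- c) (pert A' (Num.conj c) z).
    by move=> Mz; rewrite (pert_swap np rM).
  have tw z : N z -> pert A' (Num.conj c) (pert A (- c) z) = pert A (- c) (pert A' (Num.conj c) z).
    by move=> Nz; rewrite (pert_swap np rN).
  rewrite (iter_comp n sA sA' sw Mx) -(iter_iter_swap n n sA sA' sw Mx).
  rewrite (iter_pert_inner _ _ rM rN) //; last first.
    by apply: iter_stable => // z; exact: gauge_stable rN.
  rewrite (iter_comp n tA tA' tw Ny) -/Y.
  rewrite -(iter_comp (M := N)) //; first exact: (pert_stable rN).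
  by move=> z Nz; rewrite (pert_self_swap np rN).
have q0 : 0 <= q by exact: sqr_ge0.
have bS u v : cabs (inner u (S v)) <= s * (nm u * nm v).
  apply: le_trans (cauchy_schwarz _ _) _; rewrite mulrCA ler_wpM2l ?nm_ge0 //.
have -> : inner X (S Y) = inner (iter n (gauge c) x) (S (iter n (gauge c) y))
     - inner X (S (iter n K Y - Y)) :> R[i].
  by rewrite E (linfunB _ _ lS) inBr opprB addrC subrK.
have q1 : 1 <= 1 + q by rewrite lerDl.
have hc : 0 <= 1 + cabs c * r by rewrite addr_ge0 // mulr_ge0 ?cabs_ge0.
apply: le_trans (cabsD _ _) _; rewrite cabsN mulrDr mulrDl lerD //.
  apply: le_trans (bS _ _) _; rewrite -mulrA ler_wpM2l //.
  rewrite expr2 mulrACA ler_pM ?nm_ge0 //.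
    exact: iter_gauge_le rM Mx.
  exact: iter_gauge_le rN Ny.
apply: le_trans (bS _ _) _; rewrite -mulrA ler_wpM2l //.
apply: (@le_trans _ _ (nm X * (((1 + q) ^+ n - 1) * nm Y))).
  rewrite ler_wpM2l ?nm_ge0 //; exact: (iter_pert_square_near np rN).
rewrite mulrCA -[leRHS]mulrA ler_wpM2l ?subr_ge0 ?exprn_ege1 //.
rewrite expr2 mulrACA ler_pM ?nm_ge0 //.
  by have := iter_pert_le rM (- c) n Mx; rewrite cabsN.
by have := iter_pert_le (red_sym np rN) (Num.conj c) n Ny; rewrite cabsJ.
Qed.

End Commutant.

End FugledeBounded.

(** * Powers of 1 + t c A as polynomials in t *)

Section PerturbationPolynomial.
Context {R : realType} {H : hilbertType R}.
Implicit Types (x y u v w : H) (M : set H) (c t : R[i]).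
Variables A A' : operator H.
Hypothesis np : normal_pair A A'.

Lemma inner_suml n (F : 'I_n -> H) y :
  inner (\sum_(i < n) F i) y = \sum_(i < n) inner (F i) y :> R[i].
Proof. by apply: (big_morph (fun x => inner x y)) => [a b|]; [exact: inDl | exact: in0l]. Qed.

Lemma inner_sumr n (F : 'I_n -> H) y :
  inner y (\sum_(i < n) F i) = \sum_(i < n) inner y (F i) :> R[i].
Proof. by apply: (big_morph (fun x => inner y x)) => [a b|]; [exact: inDr | exact: in0r]. Qed.

Lemma bounded_reducing_le M r r' : r <= r' ->
  bounded_reducing A A' M r -> bounded_reducing A A' M r'.
Proof.
move=> rr [sM r0 hM]; split=> //; first exact: le_trans rr.
move=> x Mx; have [h1 h2 h3 h4] := hM x Mx; split=> //; apply: le_trans h4 _.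
by rewrite ler_wpM2r ?nm_ge0.
Qed.

(** The coefficients form an infinite sequence vanishing beyond n, so that the recurrence v_k + c A
    v_(k-1) holds uniformly, including at the top degree. *)
Lemma iter_pert_poly M r c n x : bounded_reducing A A' M r -> M x ->
  exists v : nat -> H, [/\ forall k, M (v k), forall k, (n < k)%N -> v k = 0,
    v 0%N = x, v 1%N = (n%:R * c) *: A x &
    forall t, iter n (pert A (t * c)) x = \sum_(k < n.+1) t ^+ k *: v k].
Proof.
move=> rM Mx; have lA := np_lin np.
have sM : lsubspace M by case: rM.
elim: n => [|n [v [Mv v0 vx v1 vE]]].
  exists (fun k => if k is 0 then x else 0); split=> //.
  - by case=> //= k; exact: (proj1 sM).
  - by case.
  - by rewrite mul0r scale0r.
  - by move=> t; rewrite big_ord_recl big_ord0 expr0 scale1r addr0.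
exists (fun k => v k + c *: (if k is k'.+1 then A (v k') else 0)); split.
- move=> k; apply: subspaceD => //; apply: subspaceZ => //; case: k => [|k].
    exact: (proj1 sM).
  exact: (red_stable rM).
- case=> // k nk; rewrite v0 ?(ltnW nk) // v0 // linop0 // scaler0 addr0 //.
- by rewrite scaler0 addr0.
- by rewrite v1 vx -scalerDl [n.+1%:R]mulrS; congr (_ *: _); ring.
move=> t; rewrite iterS vE /pert.
have [|_ ->] := @linop_sum _ _ A n.+1 (fun k => t ^+ k *: v k) lA.
  by move=> k; apply: (red_dom rM); apply: subspaceZ.
under [RHS]eq_bigr do rewrite scalerDr.
rewrite big_split /=; congr (_ + _).
  by rewrite [RHS]big_ord_recr /= v0 // scaler0 addr0.
rewrite [RHS]big_ord_recl /= !scaler0 add0r scaler_sumr; apply: eq_bigr => k _.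
rewrite linopZ //; last exact: (red_dom rM).
by rewrite !scalerA /bump /= add1n exprS; congr (_ *: _); ring.
Qed.

End PerturbationPolynomial.

(** * From the polynomial estimate to the commutation with A' *)

Section FugledeTheorem.
Context {R : realType} {H : hilbertType R}.
Implicit Types (x y u v w : H) (M : set H) (c t : R[i]).
Variables A A' : operator H.
Hypothesis np : normal_pair A A'.

Variables (S : H -> H) (s : R).
Hypotheses (lS : linear S) (s0 : 0 <= s) (Sle : forall x, nm (S x) <= s * nm x).
Hypothesis cS : commutes A S.

(** Powers of conj(t) in the second argument come out of the inner product as powers of t. In degree
    1 the binomial coefficient n cancels the 1 / n. *)
Lemma pert_form_poly M N r n x y :
  bounded_reducing A A' M r -> bounded_reducing A A' N r -> M x -> N y -> (0 < n)%N ->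
  exists p : {poly R[i]},
    (forall t, p.[t] = inner (iter n (pert A (- (t / n%:R))) x)
                         (S (iter n (pert A' (Num.conj (t / n%:R))) y))) /\
    p`_1 = inner x (S (A' y)) - inner (A x) (S y).
Proof.
move=> rM rN Mx Ny n0.
have [v [_ _ vx v1 vE]] := iter_pert_poly np (- n%:R^-1) n rM Mx.
have [w [_ _ wy w1 wE]] := iter_pert_poly (np_sym np) n%:R^-1 n (red_sym np rN) Ny.
have nn0 : n%:R != 0 :> R[i] by rewrite pnatr_eq0 -lt0n.
exists (\sum_(k < n.+1) \sum_(l < n.+1) inner (v k) (S (w l)) *: 'X^(k + l)); split.
  move=> t; have -> : - (t / n%:R) = t * (- n%:R^-1) by rewrite mulrN.
  have -> : Num.conj (t / n%:R) = Num.conj t * n%:R^-1.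
    by rewrite rmorphM fmorphV rmorph_nat.
  rewrite vE wE (linfun_sum _ lS) inner_suml horner_sum; apply: eq_bigr => k _.
  rewrite inner_sumr horner_sum; apply: eq_bigr => l _.
  rewrite hornerZ hornerXn (linfunZ _ _ lS) inZl inZr rmorphXn /= conjCK exprD; ring.
rewrite -[n](prednK n0); set m := n.-1.
have {}v1 : v 1%N = - A x by rewrite v1 mulrN mulfV // scaleN1r.
have {}w1 : w 1%N = A' y by rewrite w1 mulfV // scale1r.
have E k l : (inner (v k) (S (w l)) *: 'X^(k + l) : {poly R[i]})`_1 =
    if (k + l == 1)%N then inner (v k) (S (w l)) else 0.
  by rewrite coefZ coefXn eq_sym; case: eqP; rewrite ?mulr1 ?mulr0.
rewrite coef_sum.
under eq_bigr do (rewrite coef_sum; under eq_bigr do rewrite E).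
rewrite big_ord_recl big_ord_recl [X in _ + (_ + X)]big1 ?addr0; last first.
  by move=> k _; rewrite big1 // => l _; rewrite /= /bump /=.
congr (_ + _).
  rewrite big_ord_recl big_ord_recl big1 /= ?addr0 ?add0r ?vx ?w1 //.
rewrite big_ord_recl big1 /= ?addr0 ?wy ?v1 ?inNl //.
Qed.

Lemma fuglede_weak M N r r' x y :
  bounded_reducing A A' M r -> bounded_reducing A A' N r' -> M x -> N y ->
  inner x (S (A' y)) = inner (A x) (S y) :> R[i].
Proof.
move=> rM0 rN0 Mx Ny; pose q := Num.max r r'.
have rM : bounded_reducing A A' M q by apply: bounded_reducing_le rM0; rewrite le_max lexx.
have rN : bounded_reducing A A' N q by apply: bounded_reducing_le rN0; rewrite le_max lexx orbT.
have q0 : 0 <= q by case: rM.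
apply/eqP; rewrite -subr_eq0; apply/eqP/cabs_eq0.
(* 5 = 4 + 1: the two gauged vectors contribute z^2 <= 4 with [z] as below, and the correction
   contributes at most (E + 1)^-1 * E <= 1. *)
set d := _ - _; pose K := 5 * s * (nm x * nm y).
have K0 : 0 <= K by rewrite !mulr_ge0 ?nm_ge0.
have key rho : 0 < rho -> cabs d * rho <= K.
  move=> rho0; pose E := (expR (rho * q)) ^+ 2.
  have E0 : 0 <= E by exact: sqr_ge0.
  have a0 : 0 <= rho * q by rewrite mulr_ge0 // ltW.
  have [n n0 hn] := one_plus_sqr_exp a0 E0.
  have [p [pE p1]] := pert_form_poly rM rN Mx Ny n0.
  rewrite /d -p1; apply: coef1_le_sup => // t ht; rewrite pE.
  apply: le_trans (pert_form_le np lS s0 Sle cS _ n rM rN Mx Ny) _.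
  rewrite cabsM ht cabsV cabs_nat.
  have -> : rho / n%:R * q = rho * q / n%:R by rewrite mulrAC.
  set z := (1 + _ ^+ 2) ^+ n in hn *.
  have z1 : 1 <= z by rewrite exprn_ege1 // lerDl sqr_ge0.
  have hE : ((1 + rho * q / n%:R) ^+ n) ^+ 2 <= E.
    rewrite lerXn2r ?nnegrE ?expR_ge0 ?one_plus_exp_le // exprn_ge0 // addr_ge0 // divr_ge0 //.
  have E1 : 0 < E + 1 by rewrite ltr_wpDl.
  have z2 : z <= 2.
    apply: le_trans hn _; rewrite -[2]/(1 + 1 : R) lerD2l invf_le1 //; lra.
  rewrite /K ler_wpM2r ?mulr_ge0 ?nm_ge0 // mulrC ler_wpM2r //.
  have h1 : z ^+ 2 <= 4.
    have : z * z <= 2 * 2 by rewrite ler_pM //; lra.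
    by rewrite expr2; lra.
  have h2 : (z - 1) * ((1 + rho * q / n%:R) ^+ n) ^+ 2 <= 1.
    apply: (@le_trans _ _ ((E + 1)^-1 * E)).
      by rewrite ler_pM ?sqr_ge0 //; lra.
    by rewrite mulrC ler_pdivrMr // mul1r lerDl ler01.
  lra.
apply/eqP; rewrite eq_le cabs_ge0 andbT leNgt; apply/negP => d0.
have dk : 0 < (K + 1) / cabs d by rewrite divr_gt0 // ltr_wpDl.
have := key _ dk; rewrite [cabs d * _]mulrC divfK ?gt_eqF //; lra.
Qed.

(** Totality of the bounded vectors is used twice: testing A S' x - S' A x, for x bounded, against a
    second family of them, and then A' S y - S A' y, for arbitrary y, against such x. The domains
    match because A and A' have the same one. *)
Theorem fuglede : commutes A' S.
Proof.
have [S' hS'] := riesz_adjoint lS Sle.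
have hS x y : inner (S' x) y = inner x (S y) :> R[i] by rewrite inC -hS' -inC.
have SD' y : dom A' y -> dom A' (S y).
  by move=> Dy; apply/(np_domE _ np); case: (cS (x := y)) => //; apply/(np_domE _ np).
have cS' b : dom A' b -> dom A' (S' b) /\ A' (S' b) = S' (A' b).
  move=> Db; apply: (np_adj np) => w Dw; have [D1 e1] := cS Dw.
  by rewrite -hS' -e1 (np_inner np) // hS'.
have on_bounded M r x : bounded_reducing A A' M r -> M x -> A (S' x) = S' (A x).
  move=> rM Mx; have Dx := red_dom rM Mx; have Dx' := red_dom' np rM Mx.
  have [D1 _] := cS' x Dx'.
  have D2 : dom A (S' x) by apply/(np_domE _ (np_sym np)).
  apply/eqP; rewrite -subr_eq0; apply/eqP.
  apply: (bounded_reducing_total np) => N r' rN y Ny.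
  rewrite inBl (np_inner np) //; last exact: (red_dom' np rN).
  by rewrite !hS (fuglede_weak rM rN) ?subrr.
move=> y Dy; split; first exact: SD'.
apply/eqP; rewrite -subr_eq0; apply/eqP.
apply: (bounded_reducing_total np) => M r rM x Mx.
have Dx := red_dom rM Mx; have Dx' := red_dom' np rM Mx.
have [D1 _] := cS' x Dx'.
have D2 : dom A (S' x) by apply/(np_domE _ (np_sym np)).
rewrite inC inBr -(np_inner np) //; last exact: SD'.
by rewrite -!hS -(on_bounded _ _ _ rM Mx) (np_inner np) // subrr rmorph0.
Qed.

End FugledeTheorem.

(** * The product BA *)

Section CommutingProduct.
Context {R : realType} {H : hilbertType R}.
Implicit Types (A B N P : operator H) (x y z u v w : H).

Lemma adjoint_commutes A A' (S S' : H -> H) : normal_pair A A' ->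
  (forall x y, inner (S x) y = inner x (S' y) :> R[i]) ->
  commutes A S -> commutes A' S'.
Proof.
move=> np hS' cS b Db; apply: (np_adj np) => w Dw; have [D1 e1] := cS w Dw.
by rewrite -hS' -e1 (np_inner np) // hS'.
Qed.

(* S is the inverse of B and S' its adjoint; the record is symmetric under taking
   adjoints of everything ([ci_sym]). *)
Record commuting_inverse A A' B B' (S S' : H -> H) : Prop := CommutingInverse {
  ci_npA : normal_pair A A';
  ci_npB : normal_pair B B';
  ci_lin : linear S;
  ci_bnd : exists2 K : R, 0 <= K & forall x, nm (S x) <= K * nm x;
  ci_adj : forall x y, inner (S x) y = inner x (S' y) :> R[i];
  ci_BS : forall x, dom B (S x) /\ B (S x) = x;
  ci_SB : forall x, dom B x -> S (B x) = x;
  ci_c : commutes A S;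
  ci_c' : commutes A' S
}.

Lemma ci_sym A A' B B' S S' :
  commuting_inverse A A' B B' S S' -> commuting_inverse A' A B' B S' S.
Proof.
case=> npA npB lS [K K0 SK] hS' BS SB c c'.
have hS x y : inner (S' x) y = inner x (S y) :> R[i] by rewrite inC -hS' -inC.
split=> //.
- exact: np_sym.
- exact: np_sym.
- move=> a u v; apply/eqP; rewrite -subr_eq0; apply/eqP/inner_eq0r => w.
  by rewrite inBl inDl inZl !hS inDl inZl subrr.
- exists K => // x.
  have [->|n0] := eqVneq (nm (S' x)) 0; first by rewrite mulr_ge0 ?nm_ge0.
  have np : 0 < nm (S' x) by rewrite lt_def n0 nm_ge0.
  rewrite -(ler_pM2l np) -expr2 nm_sqr /rin hS -/(rin _ _).
  apply: le_trans (rin_le _ _) _.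
  by rewrite [leLHS]mulrC mulrA ler_wpM2r ?nm_ge0 // [leRHS]mulrC.
- by move=> z; apply: (np_adj npB) => w Dw; rewrite -hS' SB.
- move=> x Dx; apply/eqP; rewrite -subr_eq0; apply/eqP/inner_eq0r => w.
  have [D1 e1] := BS w.
  by rewrite inBl hS inC -(np_inner npB) // e1 -inC subrr.
- exact: adjoint_commutes npA hS' c.
- exact: adjoint_commutes (np_sym npA) hS' c'.
Qed.

Section Product.
Variables (A A' B B' : operator H) (S S' : H -> H).
Hypothesis ci : commuting_inverse A A' B B' S S'.

Let npA := ci_npA ci.
Let npB := ci_npB ci.
Let lA := np_lin npA.
Let lB := np_lin npB.
Let lS := ci_lin ci.
Let N := op_mul B A.

Lemma prod_dom w : dom A w -> dom N (S w) /\ N (S w) = A w.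
Proof.
move=> Dw; have [D1 e1] := ci_c ci Dw; have [D2 e2] := ci_BS ci (A w).
by rewrite /N /= e1; split.
Qed.

Lemma prod_factor x : dom N x -> A x = S (N x).
Proof. by case=> Dx DAx; rewrite /N /= (ci_SB ci). Qed.

Lemma prod_linear : linear_op N.
Proof.
split; first by rewrite /N /= linop0 //; split; exact: linop_dom0.
move=> a x y [Dx DAx] [Dy DAy]; rewrite /N /= !linopP //; split=> //; split.
  exact: (proj2 (linop_subspace lA)).
exact: (proj2 (linop_subspace lB)).
Qed.

(** Since A = S N on the domain of N and S is bounded, convergence of N u_n forces that of A u_n,
    and closedness of A applies. *)
Lemma prod_closed : closed_op N.
Proof.
apply/closed_adhP => -[x y] /adh_seq[u [v [Guv /= ux vy]]].
have Du n : dom N (u n) by case: (Guv n).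
have [K K0 SK] := ci_bnd ci.
have Au : tends (fun n => A (u n)) (S y).
  have Slip a b : nm (S a - S b) <= K * nm (a - b) by rewrite -(linfunB _ _ lS).
  apply: tends_ext (tends_lip K0 Slip vy) => n.
  by rewrite (prod_factor (Du n)); case: (Guv n) => _ /= ->.
have [|Dx Ax] := closedop_seq (np_closed npA) _ ux Au; first by move=> n; case: (Du n).
have [D2 e2] := ci_BS ci y.
by split; rewrite /= Ax.
Qed.

(* S (dom A) is a core of BA: a vector y of its domain that is graph-orthogonal to it
   satisfies A' (BA y) = - S' y, hence A'A y = - S S' y, so that
   |A y|^2 + |S' y|^2 = 0. *)
Lemma prod_core : graph N `<=` adh [set p | exists2 w, dom A w & p = (S w, A w)].
Proof.
apply: adh_core (linop_linrel prod_linear) prod_closed _ _.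
- split; first by exists 0; rewrite ?linop0 ?(linfun0 lS) //; exact: linop_dom0.
  move=> a p q [w Dw ->] [z Dz ->]; exists (a *: w + z).
    exact: (proj2 (linop_subspace lA)).
  by rewrite (linfunP _ _ _ lS) linopP.
- by move=> p [w Dw ->]; have [D e] := prod_dom Dw; split.
move=> [y q] [/= Dy ->] op.
have [D1 e1] : dom A' (N y) /\ A' (N y) = - S' y.
  apply: (np_adj npA) => w Dw; have /= := op (S w, A w) (ex_intro2 _ _ w Dw erefl).
  rewrite inNr -(ci_adj ci) (inC _ (S w)) (inC _ (A w)) -rmorphD => /eqP.
  by rewrite conjC_eq0 addrC addr_eq0 => /eqP.
have [Dy1 Dy2] := Dy.
have [D2 e2] := ci_c' ci D1.
have h : rin (A y) (A y) + rin (S' y) (S' y) = 0.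
  have DAy : dom A' (A y) by rewrite (prod_factor Dy).
  rewrite {1}/rin (np_inner npA) // {1}(prod_factor Dy) e2 e1 (linfunN _ lS).
  by rewrite inNr ReN (inC y) (ci_adj ci) -inC -/(rin _ _) addNr.
have S'y : S' y = 0 by apply: rin_le0; have := rin_ge0 (A y); lra.
have y0 : y = 0.
  by have [_ <-] := ci_BS (ci_sym ci) y; rewrite S'y linop0 //; exact: np_lin' npB.
by split=> //; rewrite y0 /N /= !linop0.
Qed.

(** Normality of B enters here: B and B' have equal norms on S' A w, and B' S' = 1. *)
Lemma prod_adj_dom w : dom A w ->
  dom N (S' w) /\ nm (N (S' w)) = nm (A w).
Proof.
move=> Dw; have [D1 e1] := ci_c' (ci_sym ci) Dw.
have [D2 e2] := ci_BS (ci_sym ci) (A w).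
have D3 : dom B (S' (A w)) by apply/(np_domE _ (np_sym npB)).
split; first by split; rewrite ?e1.
by rewrite /N /= e1 -(np_nm npB) // e2.
Qed.

(** Testing on the vectors S w gives A' y = S' z, whence B' A' y = z. Conversely the identity holds
    on the core and passes to limits. *)
Lemma prod_adjointE y z : adjoint_value N y z <-> dom (op_mul B' A') y /\ op_mul B' A' y = z.
Proof.
split=> [yz|[Dy <-] x Dx].
  have [Dy e] : dom A' y /\ A' y = S' z.
    apply: (np_adj npA) => w Dw; have [D1 e1] := prod_dom Dw.
    by rewrite -e1 yz // (ci_adj ci).
  by have [D2 e2] := ci_BS (ci_sym ci) z; split; rewrite /= ?e.
have [Dy1 Dy2] := Dy.
have [u [v [Guv /= ux vx]]] := adh_seq (prod_core (conj Dx erefl : graph N (x, N x))).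
apply: tends_inner_eq vx ux => n; have [w Dw [-> ->]] := Guv n.
by rewrite (ci_adj ci) /= (ci_SB (ci_sym ci)) // (np_inner npA).
Qed.

End Product.

Lemma prod_dom_sub A A' B B' S S' y : commuting_inverse A A' B B' S S' ->
  dom (op_mul B' A') y ->
  dom (op_mul B A) y /\ nm (op_mul B A y) = nm (op_mul B' A' y).
Proof.
move=> ci Dy; have npA := ci_npA ci; have lN := prod_linear ci.
have ci' := ci_sym ci; have lS' := ci_lin ci'.
have gy : graph (op_mul B' A') (y, op_mul B' A' y) by split.
have [u [v [Guv /= uy vy]]] := adh_seq (prod_core ci' gy).
have /choice[w hw] n : exists w, dom A' w /\ (u n, v n) = (S' w, A' w).
  by have [w Dw e] := Guv n; exists w.
have Dw n : dom A (w n) by apply/(np_domE _ (np_sym npA)); case: (hw n).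
have uE n : u n = S' (w n) by case: (hw n) => _ [].
have vE n : v n = A' (w n) by case: (hw n) => _ [].
have Du n : dom (op_mul B A) (u n) by rewrite uE; case: (prod_adj_dom ci (Dw n)).
have sA := linop_subspace (np_lin npA).
have dnm n m : nm (v n - v m) = nm (op_mul B A (u n) - op_mul B A (u m)).
  rewrite -(linopB lN) // !uE -(linfunB _ _ lS') (proj2 (prod_adj_dom ci _)); last exact: subspaceB.
  have [D1 _] := np_dom npA (Dw n); have [D2 _] := np_dom npA (Dw m).
  by rewrite !vE -(linopB (np_lin' npA)) // (np_nm npA) //; exact: subspaceB.
have [z hz] := cauchyseq_tends (cauchyseq_eq dnm (tends_cauchyseq vy)).
have [D e] := closedop_seq (prod_closed ci) Du uy hz.
rewrite -[B (A y)]/(op_mul B A y) e; split=> //; apply: tends_nm_eq hz vy => n.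
by rewrite uE vE (proj2 (prod_adj_dom ci (Dw n))) (np_nm npA).
Qed.

Lemma prod_normal A A' B B' S S' : commuting_inverse A A' B B' S S' ->
  densely_defined (op_mul B A) -> normal (op_mul B A).
Proof.
move=> ci dN; have ci' := ci_sym ci.
have adjE x : dom (op_mul B A) x ->
    dom (adjoint (op_mul B A)) x /\ adjoint (op_mul B A) x = op_mul B' A' x.
  move=> Dx; apply/adjoint_valueP => //; apply/(prod_adjointE ci).
  by split=> //; case: (prod_dom_sub ci' Dx).
apply: normal_of_norms => //; [exact: prod_linear ci | exact: prod_closed ci | |].
- move=> x; split=> [/adjE[]//|Dx].
  have /(prod_adjointE ci)[Dx' _] := (proj2 (adjoint_valueP _ _ dN)) (conj Dx erefl).
  by case: (prod_dom_sub ci Dx').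
- move=> x Dx; have [_ ->] := adjE x Dx.
  by case: (prod_dom_sub ci' Dx).
Qed.

(** As B S w = w, the pairs (S w, A w) of [prod_core] belong to the graph of A B. *)
Lemma closure_prod A A' B B' S S' : commuting_inverse A A' B B' S S' ->
  closure (graph (op_mul A B)) = graph (op_mul B A).
Proof.
move=> ci; apply/seteqP; split.
  move=> p /closure_adhP; apply: adh_min; first exact: prod_closed ci.
  move=> [x y] [/= [Dx DBx] ->].
  have [] := prod_dom ci DBx; rewrite (ci_SB ci Dx) => D e.
  by split; [exact: D | exact: esym e].
move=> p /(prod_core ci) h; apply/closure_adhP => e e0.
have [q [w Dw ->] hq] := h e e0; exists (S w, A w) => //.
by have [D1 e1] := ci_BS ci w; split; rewrite /= e1.
Qed.

(** [op_eq] leaves values outside the domain free, so normality has to be transported. The adjoints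
    are equal even as records, because [adjoint_value] tests only vectors of the domain. *)
Lemma normal_op_eq N P : op_eq N P -> normal N -> normal P.
Proof.
case=> eD eV [[lN dN] cN hN].
have eV' x : dom P x -> N x = P x by move=> Dx; apply: eV; rewrite eD.
have adjP : adjoint P = adjoint N.
  have vE y z : adjoint_value P y z = adjoint_value N y z.
    apply/propext; split=> h x Dx; first by rewrite eV // h // -eD.
    by rewrite -eV' // h // eD.
  rewrite /adjoint; congr Operator; first by apply/seteqP; split=> y [z]; rewrite ?vE => h; exists z; rewrite ?vE.
  by apply/funext => y; congr (xget 0 _); apply/funext => z; rewrite /= vE.
have gE : graph P = graph N.
  apply/seteqP; split=> -[x y] [/= Dx ->]; last by split; rewrite /= -?eD ?eV.
  by split; rewrite /= ?eD ?eV'.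
split; last first.
- rewrite adjP; case: hN => hD hV; split=> [|x [Dx DNx]].
    apply/seteqP; split=> x [/= h1 h2].
      have : dom (op_mul N (adjoint N)) x by split=> //=; rewrite eD.
      by rewrite hD => -[h3 h4]; split; rewrite /= -?eD -?eV.
    have : dom (op_mul (adjoint N) N) x by split; rewrite /= ?eD ?eV'.
    by rewrite -hD => -[h3 h4]; split; rewrite /= -?eD.
  rewrite /= -eV'//; have Dn : dom (op_mul N (adjoint N)) x by split=> //=; rewrite eD.
  have := hV x Dn => /= ->; congr (adjoint N _); apply: eV.
  by move: Dn; rewrite hD => -[].
- by rewrite /closed_op gE.
split; last by rewrite /densely_defined -eD.
split; first by rewrite -eD; exact: linop_dom0.
move=> a x y; rewrite -!eD => Dx Dy; split; first exact: (proj2 (linop_subspace lN)).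
rewrite -!eV // ?linopP //; exact: (proj2 (linop_subspace lN)).
Qed.

End CommutingProduct.

Theorem theorem5 (R : realType) (H : hilbertType R) (A B : operator H) :
  normal A -> normal B ->
  op_sub (op_mul A B) (op_mul B A) ->
  invertible B ->
  densely_defined (op_mul A B) ->
  normal (op_mul B A) /\
  (closable (op_mul A B) /\ normal (op_closure (op_mul A B))).
Proof.
move=> nA nB [ABd ABv] [S [[lS SD [K SK]] [_ SBv] [BSd BSv]]] dAB.
have lSf : linear S.
  by move=> a x y; have [_ h] := lS; case: (h a x y); rewrite ?SD.
have Sle x : nm (S x) <= `|K| * nm x.
  have := SK x; rewrite !nmE -rmorphM lecR => h; apply: le_trans h _.
  by rewrite ler_wpM2r ?nm_ge0 ?ler_norm.
have BS x : dom B (S x) /\ B (S x) = x.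
  have Dx : dom (op_mul B S) x by rewrite BSd.
  by split; [case: Dx | exact: BSv].
have SB x : dom B x -> S (B x) = x.
  by move=> Dx; have /= -> := SBv x; [case: (BS x) | split; rewrite ?SD].
(* Evaluate the inclusion of A B in B A at S x, where B S x = x, and apply S. *)
have cS : commutes A S.
  move=> x Dx; have [D1 e1] := BS x.
  have DAB : dom (op_mul A B) (S x) by split; rewrite ?e1.
  have [D2 D3] := ABd _ DAB; split=> //.
  by have /= := ABv _ DAB; rewrite e1 => ->; rewrite SB.
have npA := normal_np nA; have npB := normal_np nB.
have [S' hS'] := riesz_adjoint lSf Sle.
have ci : commuting_inverse A (adjoint A) B (adjoint B) S S'.
  split=> //; first by exists `|K|.
  by apply: (fuglede npA lSf _ Sle cS).
have dBA : densely_defined (op_mul B A).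
  move=> O O0 oO; have [x [Ox Dx]] := dAB O O0 oO.
  by exists x; split=> //; exact: ABd.
have nBA := prod_normal ci dBA.
have cE := closure_prod ci.
split=> //; split.
  by move=> x y z; rewrite cE => -[_ /= ->] [_ /= ->].
(* The values of [op_closure] are picked by [xget], hence are known only on its domain; there the
   graph of B A determines them. *)
apply: normal_op_eq nBA; split.
  apply/seteqP; split=> x /=.
    by move=> Dx; exists (op_mul B A x); rewrite cE; split.
  by move=> [y]; rewrite cE => -[].
move=> x Dx; rewrite [RHS]/=.
have h : closure (graph (op_mul A B)) (x, op_mul B A x) by rewrite cE; split.
have := @xgetI _ 0 [set y | closure (graph (op_mul A B)) (x, y)] _ h.
by rewrite /= cE => -[_ /= ->].
Qed.
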